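(* Let $n\ge 2$. For the cyclic Nakayama algebra $\Lambda^n_n$, the size of a full weak exceptional collection is $s(\Lambda^n_n)=n$, and the number of distinct full weak exceptional sequences is $\#(\Lambda^n_n)=n^n$.
   Context: Let $K$ be a field. For integers $n\ge 2$ and $k\ge 2$, $\Lambda^k_n$ denotes the selfinjective Nakayama $K$-algebra given by the cyclic quiver with vertices $1,\dots,n$ and arrows $\eta_i:i\to i+1$ for $1\le i\le n-1$ and $\eta_n:n\to 1$, modulo all paths of length $k$, so that every indecomposable projective module has length $k$. The projective $P_i$ is uniserial with composition factors from the top $S_i,S_{i+1},S_{i+2},\dots$ (indices mod $n$). For a finite dimensional algebra $A$: a (finite dimensional) module $M$ is weak exceptional if $\mathrm{Hom}_A(M,M)\cong K$ and $\mathrm{Ext}^1_A(M,M)=0$. A pair $(M,N)$ is a weak exceptional pair if $M,N$ are weak exceptional, $\mathrm{Hom}_A(N,M)=0$ and $\mathrm{Ext}^1_A(N,M)=0$. (Higher extensions are allowed to be nonzero.) A tuple $(M_1,\dots,M_r)$ is a weak exceptional sequence (or collection) if $(M_i,M_j)$ is a weak exceptional pair for all $1\le i<j\le r$. Sequences are ordered sequences of isomorphism classes of modules. The size of such a sequence is the number of distinct modules in it. Write $s(A)$ for the supremum of the sizes of weak exceptional sequences of $A$; a weak exceptional sequence is full if its size equals $s(A)$; $\#(A)$ is the number of distinct full weak exceptional sequences of $A$. *)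

(* Defs.v *)
From HB Require Import structures.
From mathcomp Require Import all_boot all_order all_algebra all_field.
From mathcomp Require Import boolp classical_sets functions cardinality.

Set Implicit Arguments.
Unset Strict Implicit.
Unset Printing Implicit Defensive.

Import Order.TTheory GRing.Theory.
Local Open Scope ring_scope.

(** * Finite-dimensional modules and weak exceptional sequences *)

(* Finite-dimensional right A-modules, acting on row vectors: v . a is
   [v *m fdact M a]. *)
Record fdmod (K : fieldType) (A : falgType K) := FdMod {
  fddim : nat;
  fdact :> {lrmorphism A -> 'M[K]_fddim}
}.

Section Modules.

Variables (K : fieldType) (A : falgType K).
Implicit Types M N E : fdmod A.

(* A homomorphism M -> N is the matrix X of a linear map v |-> v *m X that
   commutes with the actions; see [homP]. *)
Definition hom M N : {vspace 'M[K]_(fddim M, fddim N)} :=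
  (\bigcap_(a <- vbasis {:A})
     lker (linfun (mulmx (M a) \- mulmxr (N a))))%VS.

Lemma homP M N (X : 'M[K]_(fddim M, fddim N)) :
  reflect (forall a, M a *m X = X *m N a) (X \in hom M N).
Proof.
have inI (s : seq A) : reflect {in s, forall a, M a *m X = X *m N a}
    (X \in \bigcap_(a <- s) lker (linfun (mulmx (M a) \- mulmxr (N a))))%VS.
  elim: s => [|a s IHs]; first by rewrite big_nil memvf; constructor.
  rewrite big_cons memv_cap memv_ker lfunE /= subr_eq0.
  apply: (iffP andP) => [[/eqP aX /IHs sX] b|sX].
    by rewrite inE => /predU1P[->|/sX].
  split; first by apply/eqP/sX; rewrite mem_head.
  by apply/IHs => b sb; apply: sX; rewrite inE sb orbT.
apply: (iffP (inI _)) => [sX a|aX a _]; last exact: aX.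
rewrite (coord_vbasis (memvf a)) !linear_sum mulmx_suml.
apply: eq_bigr => i _; rewrite !linearZ -scalemxAl /=.
by congr (_ *: _); apply: sX; apply: mem_nth; rewrite size_tuple.
Qed.

Definition fdmod_iso M N : Prop :=
  exists X, exists Y, [/\ X \in hom M N, Y \in hom N M,
    X *m Y = 1%:M & Y *m X = 1%:M].

Definition iso_class M : set (fdmod A) := [set N | fdmod_iso M N]%classic.

(* 0 -> N --f--> E --g--> M -> 0 *)
Definition short_exact N E M
    (f : 'M[K]_(fddim N, fddim E)) (g : 'M[K]_(fddim E, fddim M)) : Prop :=
  [/\ f \in hom N E, g \in hom E M, row_free f, row_full g
    & (f == kermx g)%MS].

(* Yoneda's Ext^1(M, N) is trivial: every extension of M by N splits. *)
Definition ext1_eq0 M N : Prop :=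
  forall E (f : 'M[K]_(fddim N, fddim E)) (g : 'M[K]_(fddim E, fddim M)),
    short_exact f g -> exists2 h, h \in hom M E & h *m g = 1%:M.

Definition weak_exceptional M : Prop :=
  \dim (hom M M) = 1%N /\ ext1_eq0 M M.

Definition weak_exceptional_pair M N : Prop :=
  [/\ weak_exceptional M, weak_exceptional N, hom N M = 0%VS & ext1_eq0 N M].

Definition weak_exceptional_sequence (r : nat) (M : 'I_r -> fdmod A) : Prop :=
  (forall i, weak_exceptional (M i)) /\
  (forall i j : 'I_r, (i < j)%N -> weak_exceptional_pair (M i) (M j)).

Local Open Scope classical_set_scope.

(* Weak exceptional sequences, as sequences of isomorphism classes *)
Definition wes : set (seq (set (fdmod A))) :=
  [set s | exists r (M : 'I_r -> fdmod A),
     weak_exceptional_sequence M /\ s = [seq iso_class (M i) | i <- enum 'I_r]].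

Definition wes_size (s : seq (set (fdmod A))) : nat := size (undup s).

(* s(A) = m; no m qualifies when s(A) is infinite. *)
Definition max_wes_size (m : nat) : Prop := isLub (wes_size @` wes) m.

Definition full_wes : set (seq (set (fdmod A))) :=
  [set s | wes s /\ max_wes_size (wes_size s)].

End Modules.

Arguments wes {K} A.
Arguments max_wes_size {K} A m.
Arguments full_wes {K} A.

(** * The selfinjective Nakayama algebra of the cyclic quiver *)

(* For 2 <= n and 1 <= k, the basis vector (i, l) is the path of length l < k
   starting at the vertex i : 'Z_n of the cyclic quiver, which ends at
   i + l%:R; see [nakayama_path_mul].  The indexing by 'Z_n and 'I_k.-1.+1
   makes the type a nonzero algebra for all n and k (with n < 2 read as 2 and
   k = 0 read as 1).  Paths compose from left to right, so that the right
   module e_i Lambda spanned by the paths starting at i has composition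
   factors S_i, S_{i+1}, ... from the top. *)
Definition nakayama (K : fieldType) (n k : nat) : Type :=
  {ffun 'Z_n * 'I_k.-1.+1 -> K}.

Section Nakayama.

Variables (K : fieldType) (n k : nat).
Local Notation Lambda := (nakayama K n k).

HB.instance Definition _ := Vector.copy Lambda {ffun 'Z_n * 'I_k.-1.+1 -> K^o}.

Definition nakayama_coef (a : Lambda) (i : 'Z_n) (l : nat) : K :=
  (a : {ffun _ -> _}) (i, inord l).

Definition nakayama_one : Lambda := [ffun p : 'Z_n * 'I_k.-1.+1 => (p.2 == ord0)%:R].

(* A path (i, l) factors as (i, m) followed by (i + m, l - m), for m <= l. *)
Definition nakayama_mul (a b : Lambda) : Lambda :=
  [ffun p : 'Z_n * 'I_k.-1.+1 => \sum_(m < p.2.+1)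
     nakayama_coef a p.1 m * nakayama_coef b (p.1 + m%:R) (p.2 - m)].

Local Notation coef := nakayama_coef.

Lemma nakayamaP (a b : Lambda) :
  (forall i l, (l < k.-1.+1)%N -> coef a i l = coef b i l) -> a = b.
Proof.
move=> eq_ab; apply/ffunP => -[i l].
by have := eq_ab i l (ltn_ord l); rewrite /coef inord_val.
Qed.

Lemma nakayama_coefD (a b : Lambda) i l : coef (a + b) i l = coef a i l + coef b i l.
Proof. by rewrite /coef ffunE. Qed.

Lemma nakayama_coefZ c (a : Lambda) i l : coef (c *: a) i l = c * coef a i l.
Proof. by rewrite /coef ffunE. Qed.

Lemma nakayama_coef1 i l : (l < k.-1.+1)%N -> coef nakayama_one i l = (l == 0)%:R.
Proof. by move=> ltl; rewrite /coef ffunE -val_eqE /= inordK. Qed.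

Lemma nakayama_coefM (a b : Lambda) i l : (l < k.-1.+1)%N ->
  coef (nakayama_mul a b) i l =
  \sum_(m < l.+1) coef a i m * coef b (i + m%:R) (l - m).
Proof. by move=> ltl; rewrite {1}/coef ffunE /= inordK. Qed.

Lemma nakayama_coefM_rev (a b : Lambda) i l : (l < k.-1.+1)%N ->
  coef (nakayama_mul a b) i l =
  \sum_(m < l.+1) coef a i (l - m) * coef b (i + (l - m)%:R) m.
Proof.
move=> ltl; rewrite nakayama_coefM // (reindex_inj rev_ord_inj) /=.
by apply: eq_bigr => m _; rewrite subSS subKn // -ltnS.
Qed.

Lemma nakayama_mulA : associative nakayama_mul.
Proof.
move=> a b c; apply: nakayamaP => i l ltl; rewrite nakayama_coefM // nakayama_coefM_rev //.
pose F (j m : nat) :=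
  coef a i j * (coef b (i + j%:R) (l - j - m) * coef c (i + (l - m)%:R) m).
transitivity (\sum_(j < l.+1) \sum_(m < l.+1 | (m <= l - j)%N) F j m).
  apply: eq_bigr => /= -[j /= lej] _; rewrite ltnS in lej.
  rewrite nakayama_coefM_rev ?(leq_ltn_trans (leq_subr _ _)) // big_distrr /=.
  rewrite (big_ord_narrow_leq (leq_subr _ _)).
  apply: eq_bigr => -[m /= lem] _; rewrite ltnS in lem.
  rewrite /F -addrA -natrD subnAC subnKC // leq_subRL ?(leq_trans lem) ?leq_subr //.
  by rewrite addnC -leq_subRL.
rewrite (exchange_big_dep predT) //=; apply: eq_bigr => -[m /= lem] _.
rewrite ltnS in lem.
transitivity (\sum_(j < l.+1 | (j <= l - m)%N) F j m).
  apply: eq_bigl => j; rewrite -ltnS -(ltnS j) -!subSn ?leq_ord //.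
  by rewrite -subn_gt0 -(subn_gt0 j) -!subnDA addnC.
rewrite (big_ord_narrow_leq (leq_subr _ _)).
rewrite nakayama_coefM ?(leq_ltn_trans (leq_subr _ _)) // big_distrl /=.
by apply: eq_bigr => j _; rewrite /F subnAC mulrA.
Qed.

Lemma nakayama_mul1l : left_id nakayama_one nakayama_mul.
Proof.
move=> a; apply: nakayamaP => i l ltl.
rewrite nakayama_coefM // big_ord_recl subn0 addr0 nakayama_coef1 //= mul1r big1 ?addr0 //.
by move=> m _; rewrite nakayama_coef1 ?mul0r // (leq_ltn_trans _ ltl).
Qed.

Lemma nakayama_mul1r : right_id nakayama_one nakayama_mul.
Proof.
move=> a; apply: nakayamaP => i l ltl.
rewrite nakayama_coefM_rev // big_ord_recl subn0 nakayama_coef1 //= mulr1 big1 ?addr0 //.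
by move=> m _; rewrite nakayama_coef1 ?mulr0 // (leq_ltn_trans _ ltl).
Qed.

Lemma nakayama_mulDl : left_distributive nakayama_mul +%R.
Proof.
move=> a b c; apply: nakayamaP => i l ltl.
rewrite nakayama_coefD !nakayama_coefM // -big_split.
by apply: eq_bigr => m _; rewrite nakayama_coefD mulrDl.
Qed.

Lemma nakayama_mulDr : right_distributive nakayama_mul +%R.
Proof.
move=> a b c; apply: nakayamaP => i l ltl.
rewrite nakayama_coefD !nakayama_coefM // -big_split.
by apply: eq_bigr => m _; rewrite nakayama_coefD mulrDr.
Qed.

Lemma nakayama_one_neq0 : nakayama_one != 0.
Proof. by apply/eqP => /ffunP/(_ (0, ord0))/eqP; rewrite !ffunE oner_eq0. Qed.

HB.instance Definition _ := GRing.Zmodule_isNzRing.Build Lambda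
  nakayama_mulA nakayama_mul1l nakayama_mul1r nakayama_mulDl nakayama_mulDr
  nakayama_one_neq0.

Lemma nakayama_scaleAl c (a b : Lambda) : c *: (a * b) = c *: a * b.
Proof.
apply: nakayamaP => i l ltl; rewrite nakayama_coefZ !nakayama_coefM // mulr_sumr.
by apply: eq_bigr => m _; rewrite nakayama_coefZ mulrA.
Qed.

Lemma nakayama_scaleAr c (a b : Lambda) : c *: (a * b) = a * (c *: b).
Proof.
apply: nakayamaP => i l ltl; rewrite nakayama_coefZ !nakayama_coefM // mulr_sumr.
by apply: eq_bigr => m _; rewrite nakayama_coefZ mulrCA.
Qed.

HB.instance Definition _ := GRing.Lmodule_isLalgebra.Build K Lambda nakayama_scaleAl.
HB.instance Definition _ := GRing.Lalgebra_isAlgebra.Build K Lambda nakayama_scaleAr.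
HB.instance Definition _ := Algebra_isFalgebra.Build K Lambda.

Definition nakayama_path (i : 'Z_n) (l : nat) : Lambda :=
  [ffun p : 'Z_n * 'I_k.-1.+1 => ((p.1 == i) && (p.2 == l :> nat))%:R].

Lemma nakayama_path_mul i l j m :
  nakayama_path i l * nakayama_path j m =
  if j == i + l%:R then nakayama_path i (l + m) else 0.
Proof.
have coef_path h d h' d' : (d' < k.-1.+1)%N ->
    coef (nakayama_path h d) h' d' = ((h' == h) && (d' == d))%:R.
  by move=> ltd; rewrite /coef ffunE /= inordK.
apply: nakayamaP => i' l' ltl'; rewrite nakayama_coefM //.
pose c : K := ((i' == i) && (j == i + l%:R) && (l' == l + m)%N)%:R.
transitivity c; last first.
  rewrite /c; case: ifP => _; last by rewrite /coef ffunE andbF.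
  by rewrite coef_path // andbT.
transitivity (\sum_(t < l'.+1 | t == l :> nat) c).
  rewrite [RHS]big_mkcond; apply: eq_bigr => -[t /= let'] _; rewrite ltnS in let'.
  rewrite !coef_path ?(leq_ltn_trans _ ltl') ?leq_subr //.
  case: (t =P l) => [tl|_]; last by rewrite andbF mul0r.
  rewrite andbT -natrM mulnb /c -tl -(eqn_add2l t (l' - t)) subnKC //.
  by case: (i' =P i) => //= ->; rewrite eq_sym.
case: (ltnP l l'.+1) => [lel|gtl].
  by rewrite (big_pred1 (Ordinal lel)).
rewrite big_pred0 => [|t]; last by rewrite ltn_eqF // (leq_trans _ gtl).
by rewrite /c [(l' == _)%N]ltn_eqF ?andbF // (leq_trans gtl) ?leq_addr.
Qed.

End Nakayama.

(* Main.v *)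
Require Import Defs.
From mathcomp Require Import all_boot all_order all_algebra all_field.
From mathcomp Require Import boolp classical_sets functions cardinality.
From HB Require Import structures.
From mathcomp Require Import zify.

Set Implicit Arguments.
Unset Strict Implicit.
Unset Printing Implicit Defensive.

Import Order.TTheory GRing.Theory Defs.
Local Open Scope ring_scope.

(** Weak exceptional modules are bricks, and a brick over a Nakayama algebra is
    uniserial ([brick_iso_uniserial]): it is determined by its top [S_i] and its
    length, that is, by an arc of at most [n] consecutive vertices of the cycle.
    Conversely, all [n ^ 2] such modules are weak exceptional, because a vertex
    occurs at most once in a uniserial module.  Let [a = (i, l)] and [b = (j, m)] be
    given by top and length, and let [t] be the number of steps from [i] to [j].
    Lifting the top of [b] shows that [Hom(b, a)] is nonzero exactly when
    [t < l <= t + m], and [Ext^1(b, a)] exactly when [l <= t] and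
    [0 <= t + m - n < l] ([hom_uniserial0], [hom_uniserialN0], [ext_uniserial0],
    [ext_uniserialN0]).

    These conditions become symmetric when the order of the sequence is turned into
    geometry.  For a sequence of [r] modules, replace every vertex by [r] points, and
    let the [a]-th module with top [i] and length [l] be the arc of [r * l] points
    that starts at the point [r * i + a] of a circle of [r * n] points.  Then a
    sequence is weak exceptional exactly when its arcs are pairwise noncrossing,
    that is, nested or disjoint ([wep_noncrossing], [wep_codes_noncrossing]).

    The rest is combinatorics.  Two arcs of such a family share no end point, since
    end points are distinct modulo [r]; therefore an interval of [L] points contains
    at most [L / r] of the arcs ([card_within]), and [r <= n] ([noncrossing_leq]).
    If [r = n], then counting shows that an arc of [n * l] points contains exactly
    [l] starts, and that [l] is the least positive [e] such that at most [e] arcs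
    start in the first [n * e] points from the start of the arc on
    ([noncrossing_unique]).  So the starts determine the lengths, as in a parking
    problem.  Conversely, the lengths obtained in this way from arbitrary starts
    give a noncrossing family ([park_noncrossing]).  Hence the full sequences
    correspond to the [n ^ n] sequences of tops. *)

(** * Noncrossing arcs on a circle *)

Section Arcs.
Local Open Scope nat_scope.
Variables (r n : nat) (x : 'I_r -> nat).
Hypothesis x_lt : forall a, x a < r * n.
Hypothesis x_inj : forall a b, x a = x b %[mod r] -> a = b.
Implicit Types (a b c p : 'I_r) (l : 'I_r -> nat) (e u L : nat).

(** The circle has [r * n] points, [x a] is the point where the arc of [a] starts,
    and [gap a b] is the clockwise distance from [x a] to [x b].  The starts are
    distinct modulo [r] while arc lengths are multiples of [r]: two different arcs
    share no end point. *)
Definition gap a b : nat := if x a <= x b then x b - x a else x b + r * n - x a.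

Lemma gap_lt a b : gap a b < r * n.
Proof. by rewrite /gap; have := x_lt a; have := x_lt b; case: (leqP (x a)); lia. Qed.

Lemma gapxx a : gap a a = 0.
Proof. by rewrite /gap leqnn subnn. Qed.

Lemma gapD a b c :
  gap a b + gap b c = gap a c \/ gap a b + gap b c = gap a c + r * n.
Proof.
rewrite /gap; have := x_lt a; have := x_lt b; have := x_lt c.
by case: (leqP (x a) (x b)); case: (leqP (x b) (x c)); case: (leqP (x a) (x c)); lia.
Qed.

Lemma gap_sym a b : a != b -> gap a b + gap b a = r * n.
Proof.
move=> neq_ab; have: x a != x b.
  by apply: contra neq_ab => /eqP eq_x; apply/eqP/x_inj; rewrite eq_x.
rewrite /gap; have := x_lt a; have := x_lt b.
by case: (leqP (x a) (x b)); case: (leqP (x b) (x a)); lia.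
Qed.

Lemma gap_mod a b q : gap a b = r * q -> a = b.
Proof.
rewrite /gap => Dq; apply: x_inj; case: leqP Dq => [xab|xba] Dq.
  by rewrite -(subnKC xab) Dq mulnC addnC modnMDl.
have: x b + r * n = x a + r * q by have := x_lt a; lia.
by move/(congr1 (modn^~ r)); rewrite ![r * _]mulnC ![_ + _ * r]addnC !modnMDl.
Qed.

Lemma r_gt0 a : 0 < r. Proof. exact: leq_ltn_trans (ltn_ord a). Qed.

Lemma gap_gt0 a b : a != b -> 0 < gap a b.
Proof.
rewrite lt0n; apply: contra => /eqP g0.
by rewrite (@gap_mod a b 0) // muln0.
Qed.

Lemma leq_cardsU (T : finType) (A B : {set T}) : #|A :|: B| <= #|A| + #|B|.
Proof. exact: leq_card_setU. Qed.

(** The arc of [a] has [r * l a] points.  Seen from [x a], the three cases are: the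
    arc of [b] is nested in that of [a]; the two are disjoint; the arc of [b] goes
    past [x a] a second time and contains the arc of [a]. *)
Definition noncrossing l a b :=
  [|| gap a b + r * l b <= r * l a,
      (r * l a <= gap a b) && (gap a b + r * l b <= r * n)
    | r * l a + r * n <= gap a b + r * l b].

Lemma noncrossing_sym l a b : a != b -> noncrossing l a b = noncrossing l b a.
Proof.
move=> neq_ab; rewrite /noncrossing; have := gap_sym neq_ab.
by move: (gap a b) (gap b a) => g h; lia.
Qed.

(** The arcs that lie in the interval of [L] points at distance [u] from [x c]. *)
Definition within l c u L :=
  [set b | (u <= gap c b) && (gap c b + r * l b <= u + L)].

Section Bound.
Variable l : 'I_r -> nat.
Hypothesis l_gt0 : forall a, 0 < l a.
Hypothesis ncl : forall a b, a != b -> noncrossing l a b.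

(** By induction on the interval.  At most one arc starts at its first point.  If
    this arc is shorter than the interval, the other arcs are nested in it or come
    after it, and the two bounds add up.  If it fills the interval, then the others
    avoid the first point, and an interval of [r * l a - 1] points contains fewer
    than [l a] arcs. *)
Lemma card_within c u L : u + L <= r * n -> r * #|within l c u L| <= L.
Proof.
elim/ltn_ind: L u => L IH u leQ; have r0 := r_gt0 c.
case: (pickP [pred a in within l c u L | gap c a == u]) => [a|none].
  rewrite !inE => /andP[/andP[_ inL] /eqP Da].
  rewrite Da leq_add2l in inL.
  have uniq_a b : gap c b = u -> b = a.
    move=> Db; apply/esym; have:= gapD c a b; have := gap_lt a b; rewrite Da Db.
    by move=> lt_ab [Dab|Dab]; apply: (@gap_mod _ _ 0); lia.
  have la0 := l_gt0 a.
  have rla0 : 0 < r * l a by rewrite muln_gt0 r0.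
  case: (ssrnat.ltngtP (r * l a) L) inL => // [ltL _|eqL _].
    have sub: within l c u L \subset
        within l c u (r * l a) :|: within l c (u + r * l a) (L - r * l a).
      apply/fintype.subsetP => b; rewrite !inE => /andP[ub bL].
      case: (eqVneq a b) => [<-|neq_ab]; first by rewrite Da !leqnn.
      have:= gapD c a b; have := gap_lt a b; have := gap_lt c b; rewrite Da.
      have:= ncl neq_ab; rewrite /noncrossing => nc lt1 lt2 eqs.
      have {eqs} Db: gap c b = u + gap a b by lia.
      by rewrite Db in ub bL *; apply/orP; lia.
    apply: (@leq_trans (r * l a + (L - r * l a))); last by rewrite subnKC // ltnW.
    apply: (@leq_trans (r * #|within l c u (r * l a)| +
                        r * #|within l c (u + r * l a) (L - r * l a)|)).
      rewrite -mulnDr leq_pmul2l //.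
      exact: leq_trans (subset_leq_card sub) (leq_cardsU _ _).
    by rewrite leq_add // IH //; clear -ltL rla0 leQ; lia.
  have sub: within l c u L \subset a |: within l c u.+1 L.-1.
    apply/fintype.subsetP => b; rewrite !inE => /andP[ub bL].
    case: eqVneq => //= neq_ba.
    have ne1 : gap c b <> u by move/uniq_a/eqP; apply/negP.
    lia.
  have := subset_leq_card sub; rewrite cardsU1 => le1.
  have h: r * #|within l c u.+1 L.-1| <= L.-1 by apply: IH; lia.
  have {}h: r * #|within l c u.+1 L.-1| < r * l a by lia.
  rewrite -eqL in le1 h *.
  rewrite ltn_pmul2l // in h.
  rewrite leq_pmul2l //; apply: leq_trans le1 _.
  by apply: leq_trans h; apply: leq_add (leq_b1 _) (leqnn _).
case: L => [|L] in IH leQ none *.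
  rewrite (_ : within _ _ _ _ = finset.set0) ?cards0 ?muln0 //.
  apply/finset.setP => b; rewrite !inE.
  have : 0 < r * l b by rewrite muln_gt0 r0 l_gt0.
  lia.
apply: (@leq_trans (r * #|within l c u.+1 L|)); last by have := IH L _ u.+1; lia.
rewrite leq_pmul2l //; apply/subset_leq_card/fintype.subsetP => b bw.
have:= none b; rewrite /= bw /= => ne; move: bw; rewrite !inE; lia.
Qed.

End Bound.

Section Full.
Variable l : 'I_r -> nat.
Hypothesis l_gt0 : forall a, 0 < l a.
Hypothesis l_len : forall a, l a <= n.
Hypothesis ncl : forall a b, a != b -> noncrossing l a b.

(** A longest arc is nested in no other one, so that every arc lies in it or in its
    complement; [card_within] applies to both. *)
Lemma noncrossing_leq : r <= n.
Proof.
case: (posnP r) => [->//|r0].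
pose a := [arg max_(i > Ordinal r0) l i].
have maxa b : l b <= l a by rewrite /a; case: arg_maxnP => // i _; apply.
have rl b : r * l b <= r * l a by rewrite leq_pmul2l.
have rln: r * l a <= r * n by rewrite leq_pmul2l // l_len.
have sub: (finset.setT : {set 'I_r}) \subset
   within l a 0 (r * l a) :|: within l a (r * l a) (r * n - r * l a).
  apply/fintype.subsetP => b _; rewrite !inE.
  case: (eqVneq a b) => [<-|neq_ab]; first by rewrite gapxx !leqnn.
  have:= ncl neq_ab; rewrite /noncrossing; have := rl b; have := gap_lt a b; lia.
have := leq_trans (subset_leq_card sub) (leq_cardsU _ _).
rewrite cardsT card_ord -(leq_pmul2l r0) mulnDr => le1.
rewrite -(leq_pmul2l r0); apply: leq_trans le1 _.
rewrite -[leqRHS](subnKC rln) leq_add // card_within //.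
by rewrite subnKC.
Qed.

Definition starts a u := [set b | gap a b < u].

(** Since no arc is longer than the circle, an arc that starts inside another one
    cannot go around and contain it. *)
Lemma start_nested a b :
  gap a b < r * l a -> gap a b + r * l b <= r * l a.
Proof.
case: (eqVneq a b) => [<-|neq_ab]; first by rewrite gapxx.
have : r * l b <= r * n by rewrite leq_mul2l l_len orbT.
have:= ncl neq_ab; rewrite /noncrossing; lia.
Qed.

Lemma card_starts_leq a : #|starts a (r * l a)| <= l a.
Proof.
have r0 := r_gt0 a; rewrite -(leq_pmul2l r0).
have rln: 0 + r * l a <= r * n by rewrite leq_pmul2l // l_len.
apply: leq_trans (card_within l_gt0 ncl a rln).
rewrite leq_pmul2l //; apply/subset_leq_card/fintype.subsetP => b.
by rewrite !inE => /start_nested.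
Qed.

Hypothesis rn : r = n.

(** By induction from the long arcs to the short ones.  If the arc of [a] is nested
    in no other, then all arcs that start outside it lie in its complement, which
    has room for [n - l a] of them.  Otherwise let [p] be the shortest arc around
    it.  An arc that starts in [p] but not in [a] is [p] itself or lies in one of
    the two parts of [p] before and after [a].  As [p] starts at the first point of
    the former part, these two parts together hold at most [l p - l a - 1] other
    arcs, and [p] is known to contain at least [l p] starts. *)
Lemma card_starts_geq a : l a <= #|starts a (r * l a)|.
Proof.
have r0 := r_gt0 a.
have [k] := ubnP (n - l a); elim: k => // k IH in a r0 * => ltk.
have rl b : r * l b <= r * n by rewrite leq_pmul2l // l_len.
have la0 := l_gt0 a; have rla0 : 0 < r * l a by rewrite muln_gt0 r0.
case: (pickP [pred p | (p != a) && (gap p a + r * l a <= r * l p)]) => [p0 p0P|none].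
  pose p := [arg min_(p < p0 | (p != a) && (gap p a + r * l a <= r * l p)) l p].
  have [/andP[pa nest] minp] : ((p != a) && (gap p a + r * l a <= r * l p)) /\
      forall b, (b != a) && (gap b a + r * l a <= r * l b) -> l p <= l b.
    by rewrite /p; case: arg_minnP.
  have gpa := gap_gt0 pa.
  have lap : l a < l p by rewrite -(ltn_pmul2l r0); lia.
  have := IH p r0; have := l_len p => lpn /(_ _) IHp.
  have {IHp} IHp : l p <= #|starts p (r * l p)| by apply: IHp; lia.
  pose S1 := within l p 1 (gap p a).-1.
  pose S2 := within l p (gap p a + r * l a) (r * l p - r * l a - gap p a).
  have sub : starts p (r * l p) \subset p |: (starts a (r * l a) :|: (S1 :|: S2)).
    apply/fintype.subsetP => b; rewrite !inE => bp.
    case: (eqVneq b p) => //= neq_bp.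
    have bnest := start_nested bp.
    case: ltnP => //= aleb.
    have neq_ab : a != b by apply: contraTneq aleb => <-; rewrite gapxx; lia.
    have gpb : 0 < gap p b by rewrite gap_gt0 // eq_sym.
    have gab := gap_sym neq_ab.
    (* The arc of b does not contain that of a, since p is the shortest one that does. *)
    have nba : ~~ (gap b a + r * l a <= r * l b).
      apply/negP => ba; have:= minp b; rewrite eq_sym neq_ab ba => /(_ isT).
      rewrite -(leq_pmul2l r0); lia.
    have := ncl neq_ab; rewrite /noncrossing; have := gapD p a b; lia.
  have := leq_trans (subset_leq_card sub) (leq_cardsU _ _); rewrite cards1.
  have := leq_cardsU (starts a (r * l a)) (S1 :|: S2).
  have := leq_cardsU S1 S2.
  have h1 : r * #|S1| <= (gap p a).-1.
    by apply: card_within => //; have := rl p; lia.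
  have h2 : r * #|S2| <= r * l p - r * l a - gap p a.
    by apply: card_within => //; have := rl p; lia.
  have: r * (#|S1| + #|S2|) < r * (l p - l a).
    by rewrite mulnDr mulnBr; move: h1 h2 gpa; clear -nest; lia.
  rewrite ltn_pmul2l //; lia.
have sub : ~: starts a (r * l a) \subset within l a (r * l a) (r * n - r * l a).
  apply/fintype.subsetP => b; rewrite !inE -leqNgt => aleb.
  have neq_ab : a != b by apply: contraTneq aleb => <-; rewrite gapxx; lia.
  have := none b; rewrite /= eq_sym neq_ab /=.
  have := ncl neq_ab; rewrite /noncrossing; have := gap_sym neq_ab; have := rl a; lia.
have := subset_leq_card sub; rewrite cardsCs finset.setCK card_ord.
have := card_within l_gt0 ncl a (u := r * l a) (L := r * n - r * l a).
rewrite -mulnBr leq_pmul2l // mulnBr.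
have := rl a; have := l_len a.
have := max_card (mem (starts a (r * l a))); rewrite card_ord; lia.
Qed.

(** The arcs that start in the last [r * (l a - e)] points of the arc of [a] are
    nested in it and do not end where it does, so that there are fewer than
    [l a - e] of them. *)
Lemma card_starts_gt a e : 0 < e -> e < l a -> e < #|starts a (r * e)|.
Proof.
move=> e0 el; have r0 := r_gt0 a.
have re0 : 0 < r * e by rewrite muln_gt0 r0.
have rel : r * e < r * l a by rewrite ltn_pmul2l.
have rl : r * l a <= r * n by rewrite leq_pmul2l // l_len.
pose S := within l a (r * e) (r * l a - r * e).-1.
have sub : starts a (r * l a) \subset starts a (r * e) :|: S.
  apply/fintype.subsetP => b; rewrite !inE => bl; have := start_nested bl.
  case: ltnP => //= eb.
  have neq_ab : a != b by apply: contraTneq eb => <-; rewrite gapxx; lia.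
  have : gap a b + r * l b <> r * l a.
    move=> eqg; case/eqP: neq_ab; apply: (@gap_mod _ _ (l a - l b)).
    by rewrite mulnBr; lia.
  lia.
have := leq_trans (subset_leq_card sub) (leq_cardsU _ _).
have := card_starts_geq a.
have : r * #|S| < r * (l a - e).
  rewrite mulnBr.
  have := card_within l_gt0 ncl a (u := r * e) (L := (r * l a - r * e).-1).
  rewrite -/S; lia.
rewrite ltn_pmul2l //; lia.
Qed.

End Full.

Section Park.
Hypothesis rn : r = n.

Lemma park_ex a : exists e, (0 < e) && (#|starts a (r * e)| <= e).
Proof.
exists r; rewrite (r_gt0 a).
by have := max_card (mem (starts a (r * r))); rewrite card_ord.
Qed.

(** The only possible length of the arc of [a] in a noncrossing family of maximal
    size, computed from the starts alone. *)
Definition park a := ex_minn (park_ex a).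

Lemma park_gt0 a : 0 < park a.
Proof. by rewrite /park; case: ex_minnP => e /andP[]. Qed.

Lemma card_starts_park a : #|starts a (r * park a)| <= park a.
Proof. by rewrite /park; case: ex_minnP => e /andP[]. Qed.

Lemma park_min a e : 0 < e -> #|starts a (r * e)| <= e -> park a <= e.
Proof. by rewrite /park; case: ex_minnP => m _ min e0 le; apply: min; rewrite e0. Qed.

Lemma park_len a : park a <= n.
Proof.
rewrite -rn; apply: park_min; first exact: r_gt0 a.
by have := max_card (mem (starts a (r * r))); rewrite card_ord.
Qed.

(** Let [r * t] be the largest multiple of [r] below the distance from [x a] to
    [x b].  By minimality of [park a] at least [t + 1] arcs start in the arc of [a] strictly
    before [x b], so at most [e = park a - t - 1] start in the rest of it.  Hence
    the [r * e] points from [x b] on, which lie in the arc of [a], contain at most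
    [e] starts, and [park b <= e]. *)
Lemma park_nested a b :
  a != b -> gap a b < r * park a -> gap a b + r * park b <= r * park a.
Proof.
move=> neq_ab ltab; have r0 := r_gt0 a.
pose t := gap a b %/ r; pose d := gap a b %% r.
have Dg : gap a b = r * t + d by rewrite mulnC -divn_eq.
have d0 : 0 < d.
  rewrite lt0n; apply: contra neq_ab => /eqP d0; apply/eqP/(@gap_mod _ _ t).
  by rewrite Dg d0 addn0.
have dr : d < r by rewrite ltn_mod.
have lt_t : t < park a by rewrite -(ltn_pmul2l r0); lia.
have rt1 : r * t.+1 <= r * park a by rewrite leq_pmul2l.
have rp : r * park a <= r * n by rewrite leq_pmul2l // park_len.
pose S := a |: starts a (r * t).
have cardS : t < #|S|.
  case: (posnP t) => [->|t0]; first by rewrite (cardD1 a) setU11.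
  apply: (@leq_trans #|starts a (r * t)|); last by apply/subset_leq_card/finset.subsetUr.
  by rewrite ltnNge; apply/negP => /(park_min t0); rewrite leqNgt lt_t.
have SE c : c \in S -> gap a c < gap a b.
  rewrite !inE => /predU1P[->|]; last by lia.
  by rewrite gapxx gap_gt0.
pose e := park a - t.+1.
have disj (X : {set 'I_r}) : (forall c, c \in X -> gap a b <= gap a c < r * park a) ->
  #|X| <= e.
  move=> XP; have: S :|: X \subset starts a (r * park a).
    apply/fintype.subsetP => c; rewrite finset.inE => /orP[/SE|/XP]; rewrite inE; lia.
  move/subset_leq_card; rewrite cardsU (_ : S :&: X = finset.set0) ?cards0 ?subn0.
    move/leq_trans/(_ (card_starts_park a)) => le.
    by rewrite leq_subRL //; apply: leq_trans le; rewrite leq_add2r.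
  apply/finset.setP => c; rewrite finset.in_setI finset.in_set0; apply/negP => /andP[cS /XP].
  by have := SE c cS; lia.
(* As b itself starts in the rest of the arc of a, this rest is not empty. *)
have e0 : 0 < e.
  by have := disj [set b]; rewrite cards1; apply => c; rewrite inE => /eqP ->; rewrite leqnn.
have De : r * e + r * t.+1 = r * park a by rewrite -mulnDr subnK.
have rt : r * t.+1 = r * t + r by rewrite mulnS addnC.
have : park b <= e.
  apply: park_min e0 _; apply: disj => c; rewrite inE.
  have := gapD a b c; have := gap_lt a b; lia.
rewrite -(leq_pmul2l r0); lia.
Qed.

Lemma park_noncrossing a b : a != b -> noncrossing park a b.
Proof.
move=> neq_ab; rewrite /noncrossing; have gs := gap_sym neq_ab.
have := park_nested neq_ab; rewrite eq_sym in neq_ab; have := park_nested neq_ab.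
have r0 := r_gt0 a.
have : r * park a <= r * n by rewrite leq_pmul2l // park_len.
lia.
Qed.

Lemma noncrossing_unique l a :
  (forall a, 0 < l a <= n) -> (forall a b, a != b -> noncrossing l a b) ->
  l a = park a.
Proof.
move=> lP ncl; have l0 b : 0 < l b by case/andP: (lP b).
have ln b : l b <= n by case/andP: (lP b).
apply/eqP; rewrite eqn_leq park_min ?card_starts_leq // andbT.
rewrite leqNgt; apply/negP => /(card_starts_gt l0 ln ncl rn (park_gt0 a)).
by rewrite ltnNge card_starts_park.
Qed.
End Park.
End Arcs.

(** * Isomorphism invariance *)

Section FdMod.
Variables (K : fieldType) (A : falgType K).
Implicit Types M N L E : fdmod A.

Lemma hom_mul M N X a : X \in hom M N -> M a *m X = X *m N a.
Proof. by move/homP. Qed.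

Lemma hom_id M : 1%:M \in hom M M.
Proof. by apply/homP => a; rewrite mulmx1 mul1mx. Qed.

Lemma hom_comp M N L X Y : X \in hom M N -> Y \in hom N L -> X *m Y \in hom M L.
Proof.
by move=> /homP hX /homP hY; apply/homP => a; rewrite mulmxA hX -!mulmxA hY.
Qed.

Lemma fdmod_iso_refl M : fdmod_iso M M.
Proof. by exists 1%:M, 1%:M; rewrite !hom_id mulmx1. Qed.

Lemma fdmod_iso_sym M N : fdmod_iso M N -> fdmod_iso N M.
Proof. by case=> X [Y [? ? ? ?]]; exists Y, X. Qed.

Lemma fdmod_iso_trans M N L : fdmod_iso M N -> fdmod_iso N L -> fdmod_iso M L.
Proof.
move=> [X [Y [hX hY XY YX]]] [Z [T [hZ hT ZT TZ]]].
exists (X *m Z), (T *m Y); split; rewrite ?(hom_comp hX) ?(hom_comp hT) //.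
  by rewrite mulmxA -(mulmxA X) ZT mulmx1.
by rewrite mulmxA -(mulmxA T) YX mulmx1.
Qed.

Lemma iso_classE M N : iso_class M = iso_class N <-> fdmod_iso M N.
Proof.
split=> [eqMN|MN].
  have : iso_class N N by exact: fdmod_iso_refl.
  by rewrite -eqMN.
apply/seteqP; split=> L /= hL; apply: fdmod_iso_trans hL => //.
exact: fdmod_iso_sym.
Qed.

Lemma hom0_iso M M' N N' : fdmod_iso M M' -> fdmod_iso N N' ->
  hom M N = 0%VS -> hom M' N' = 0%VS.
Proof.
move=> [X [X' [hX hX' XX' X'X]]] [Y [Y' [hY hY' YY' Y'Y]]] MN0.
apply/eqP; rewrite -subv0; apply/subvP => Z hZ.
have : X *m Z *m Y' \in hom M N by rewrite !(hom_comp, hX, hZ, hY') ?(hom_comp hX).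
rewrite MN0 => /vlineP[c]; rewrite scaler0 => XZY.
have : X' *m (X *m Z *m Y') *m Y = 0 by rewrite XZY mulmx0 mul0mx.
by rewrite -!mulmxA Y'Y mulmx1 mulmxA X'X mul1mx => ->; rewrite mem0v.
Qed.

(** An extension of [M'] by [N'] is one of [M] by [N] after composing both maps
    with the isomorphisms; a section of the latter composes to one of the former. *)
Lemma ext1_eq0_iso M M' N N' : fdmod_iso M M' -> fdmod_iso N N' ->
  ext1_eq0 M N -> ext1_eq0 M' N'.
Proof.
move=> [X [X' [hX hX' XX' X'X]]] [Y [Y' [hY hY' YY' Y'Y]]] MN0 E f g.
move=> [hf hg ff fg /eqmxP efg].
have ff' : row_free (Y *m f).
  apply/row_freeP; have [B fB] := row_freeP ff.
  by exists (B *m Y'); rewrite mulmxA -(mulmxA Y) fB mulmx1.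
have fg' : row_full (g *m X').
  apply/row_fullP; have [B fB] := row_fullP fg.
  by exists (X *m B); rewrite mulmxA -(mulmxA X) fB mulmx1.
have fg0 : f *m g = 0 by apply: sub_kermxP; rewrite efg.
have [|h hh hg1] := MN0 E (Y *m f) (g *m X').
  split=> //; first exact: hom_comp hf.
    exact: hom_comp hX'.
  apply/andP; split.
    by apply/sub_kermxP; rewrite -mulmxA (mulmxA f) fg0 mul0mx mulmx0.
  have : (kermx (g *m X') <= kermx g)%MS.
    apply/sub_kermxP; rewrite -[RHS](mul0mx _ X) -(mulmx_ker (g *m X')).
    by rewrite -!mulmxA X'X mulmx1.
  rewrite -efg => /submx_trans; apply; apply/submxP; exists Y'.
  by rewrite mulmxA Y'Y mul1mx.
exists (X' *m h); first exact: hom_comp hh.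
have : h *m g = X by rewrite -[LHS]mulmx1 -X'X mulmxA -(mulmxA h) hg1 mul1mx.
by rewrite -mulmxA => ->.
Qed.

Lemma brick_scalar M X : \dim (hom M M) = 1%N -> (0 < fddim M)%N ->
  X \in hom M M -> exists c, X = c%:M.
Proof.
move=> dim1 d0 hX; have id0 : (1%:M : 'M[K]_(fddim M)) != 0.
  case: (fddim M) d0 => // d _; exact: matrix_nonzero1.
suff: X \in <[1%:M : 'M[K]_(fddim M)]>%VS.
  by move/vlineP=> [c ->]; exists c; rewrite scalemx1.
rewrite (_ : <[_]>%VS = hom M M) //; apply/eqP.
by rewrite eqEdim dim1 dim_vline id0 -memvE hom_id.
Qed.
End FdMod.

(** * Paths of the cyclic quiver *)

Section Nakayama.
Variables (K : fieldType) (n' : nat).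
Local Notation N := n'.+2.
Local Notation A := (nakayama K N N).
Implicit Types (M E : fdmod A) (i j : 'Z_N) (s t : nat).

Definition npath i s : A := nakayama_path K N i s.

Lemma npath_mul i s j t :
  npath i s * npath j t = if j == i + s%:R then npath i (s + t) else 0.
Proof. exact: nakayama_path_mul. Qed.

Lemma npath_eq0 i s : (N <= s)%N -> npath i s = 0.
Proof.
move=> leNs; apply/ffunP => -[h l]; rewrite !ffunE /=.
by rewrite [(l == s :> nat)%N]ltn_eqF ?andbF // (leq_trans (ltn_ord l)).
Qed.

Lemma npath_coef i s h t : (t < N)%N ->
  nakayama_coef (npath i s) h t = ((h == i) && (t == s))%:R.
Proof. by move=> ltt; rewrite /nakayama_coef ffunE /= inordK. Qed.

Lemma npath_sum (a : A) : a = \sum_(p : 'Z_N * 'I_N) nakayama_coef a p.1 p.2 *: npath p.1 p.2.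
Proof.
apply/ffunP => -[h l]; rewrite sum_ffunE (bigD1 (h, l)) //= big1 => [|p neq_p].
  by rewrite !ffunE /= !eqxx /nakayama_coef inord_val addr0 [RHS]mulr1.
rewrite !ffunE /=; case: eqP => [eh|]; last by rewrite scaler0.
case: eqP => [el|]; last by rewrite scaler0.
by case/eqP: neq_p; case: p eh el => p1 p2 /= -> /ord_inj ->.
Qed.

Lemma npath_one : (1 : A) = \sum_i npath i 0.
Proof.
apply/ffunP => -[h l]; rewrite sum_ffunE (bigD1 h) //= big1 => [|i neq_i].
  by rewrite !ffunE /= eqxx addr0.
by rewrite !ffunE /= eq_sym (negPf neq_i).
Qed.

Lemma hom_npathP M E (X : 'M_(fddim M, fddim E)) :
  reflect (forall i s, (s < N)%N -> M (npath i s) *m X = X *m E (npath i s)) (X \in hom M E).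
Proof.
apply: (iffP (homP X)) => [hX i s _|hX a]; first exact: hX.
rewrite (npath_sum a) !linear_sum mulmx_suml; apply: eq_bigr => p _.
by rewrite !linearZ /= -scalemxAl hX.
Qed.

Lemma act_npath_mul M i s j t :
  M (npath i s) *m M (npath j t) = if j == i + s%:R then M (npath i (s + t)) else 0.
Proof. by rewrite -[LHS](rmorphM M) npath_mul; case: ifP; rewrite ?rmorph0. Qed.

(** * Modules given by walks *)

(** A module with basis vectors [0, ..., wdim - 1], each placed at a vertex and sent
    by the arrow leaving this vertex to the next basis vector or to zero.  All
    numbers from [wdim] on stand for zero, so that [wnext] can be iterated in [nat]. *)
Record walk := Walk {
  wdim : nat;
  wnext : nat -> nat;
  wvert : nat -> 'Z_N;
  wnext_out : forall x, (wdim <= x)%N -> (wdim <= wnext x)%N;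
  wnext_vert : forall x, (x < wdim)%N -> (wnext x < wdim)%N -> wvert (wnext x) = wvert x + 1;
  wnext_nil : forall x, (wdim <= iter N wnext x)%N
}.

Section Walk.
Variable w : walk.
Local Notation d := (wdim w).
Local Notation f := (wnext w).

Lemma iter_out s x : (d <= x)%N -> (d <= iter s f x)%N.
Proof. by move=> dx; elim: s => //= s IH; apply: wnext_out. Qed.

Lemma iter_nil s x : (N <= s)%N -> (d <= iter s f x)%N.
Proof. by move=> Ns; rewrite -(subnK Ns) iterD iter_out // wnext_nil. Qed.

Lemma iter_vert s x : (iter s f x < d)%N -> wvert w (iter s f x) = wvert w x + s%:R.
Proof.
elim: s => [|s IH]; first by rewrite addr0.
rewrite iterS => lt; have lt' : (iter s f x < d)%N.
  by rewrite ltnNge; apply: contraL lt => /wnext_out; rewrite -leqNgt.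
by rewrite wnext_vert // IH // -addrA -natr1.
Qed.

Definition walk_act (a : A) : 'M[K]_d :=
  \matrix_(p, q) \sum_(s < N) nakayama_coef a (wvert w p) s * (iter s f p == q)%:R.

Lemma walk_act_linear : linear walk_act.
Proof.
move=> c a b; apply/matrixP => p q; rewrite !mxE mulr_sumr -big_split.
apply: eq_bigr => s _ /=.
by rewrite nakayama_coefD nakayama_coefZ mulrDl mulrA.
Qed.

Lemma walk_act_monoid : monoid_morphism walk_act.
Proof.
split=> [|a b]; apply/matrixP => p q; rewrite !mxE.
  rewrite big_ord_recl big1 ?addr0 => [|s _]; last first.
    by rewrite nakayama_coef1 ?mul0r // (ltn_ord (lift ord0 s)).
  by rewrite nakayama_coef1 //= mul1r -val_eqE.
pose F s t : K := nakayama_coef a (wvert w p) s *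
  nakayama_coef b (wvert w p + s%:R) t * (iter (s + t) f p == q)%:R.
transitivity (\sum_(s < N) \sum_(t < N) F s t); last first.
  under [RHS]eq_bigr => r _ do rewrite !mxE mulr_suml.
  rewrite [RHS]exchange_big /=; apply: eq_bigr => s _.
  case: (ltnP (iter s f p) d) => [lt|ge]; last first.
    rewrite big1 => [|t _]; last first.
      by rewrite /F addnC iterD gtn_eqF ?mulr0 // (leq_trans (ltn_ord q)) // iter_out.
    rewrite big1 // => r _.
    by rewrite gtn_eqF ?mulr0 ?mul0r // (leq_trans (ltn_ord r)).
  rewrite (bigD1 (Ordinal lt)) //= [X in _ + X]big1 => [|r]; last first.
    by rewrite -val_eqE /= eq_sym => /negPf->; rewrite mulr0 mul0r.
  rewrite eqxx mulr1 addr0 mulr_sumr; apply: eq_bigr => t _.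
  by rewrite /F addnC iterD iter_vert // mulrA.
under eq_bigr => s _ do rewrite nakayama_coefM // mulr_suml.
pose G (k : nat) s : K := if (s <= k)%N then F s (k - s)%N else 0.
transitivity (\sum_(k < N) \sum_(s < N) G k s).
  apply: eq_bigr => k _; rewrite (big_ord_widen N (fun s => nakayama_coef a (wvert w p) s *
     nakayama_coef b (wvert w p + s%:R) (k - s)%N * (iter k f p == q)%:R)) //.
  rewrite big_mkcond; apply: eq_bigr => s _; rewrite ltnS /G.
  by case: ifP => // le; rewrite /F subnKC.
rewrite exchange_big; apply: eq_bigr => s _ /=.
rewrite -(big_mkord xpredT (fun k => G k s)) (@big_cat_nat _ _ _ s) //=; last exact: ltnW.
rewrite big_nat_cond big1 ?add0r => [|k]; last first.
  by rewrite andbT => /andP[_ lt]; rewrite /G leqNgt lt.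
rewrite -{1}[nat_of_ord s]add0n big_addn big_mkord.
rewrite [RHS](bigID (fun t : 'I_N => (t < N - s)%N)) /= [X in _ + X]big1 ?addr0.
  rewrite (big_ord_narrow (leq_subr s N)) /=.
  by apply: eq_bigr => t _; rewrite /G leq_addl addnK.
move=> t; rewrite -leqNgt => le; rewrite /F gtn_eqF ?mulr0 //.
by rewrite (leq_trans (ltn_ord q)) // iter_nil // -leq_subLR.
Qed.

HB.instance Definition _ := GRing.isLinear.Build K A 'M[K]_d _ walk_act walk_act_linear.
HB.instance Definition _ := GRing.isMonoidMorphism.Build A 'M[K]_d walk_act walk_act_monoid.

Definition walk_mod : fdmod A := FdMod walk_act.

Lemma walk_mod_npath i s (p q : 'I_d) :
  walk_mod (npath i s) p q = ((wvert w p == i) && (iter s f p == q))%:R.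
Proof.
rewrite mxE; case: (ltnP s N) => [lt|ge]; last first.
  rewrite gtn_eqF ?andbF; last by rewrite (leq_trans (ltn_ord q)) // iter_nil.
  by rewrite big1 // => t _; rewrite npath_coef // ltn_eqF ?andbF ?mul0r // (leq_trans _ ge).
rewrite (bigD1 (Ordinal lt)) //= big1 => [|t]; last first.
  by rewrite -val_eqE /= npath_coef // => /negPf->; rewrite andbF mul0r.
by rewrite npath_coef // eqxx andbT addr0 -natrM mulnb.
Qed.
End Walk.

Definition walk_map (w1 w2 : walk) (phi : nat -> nat) : 'M[K]_(wdim w1, wdim w2) :=
  \matrix_(p, q) (phi p == q)%:R.

(** Two numbers outside the target both stand for zero, even if they differ; this is
    the second alternative in the last hypothesis. *)
Lemma walk_hom (w1 w2 : walk) phi :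
  (forall x, (wdim w1 <= x)%N -> (wdim w2 <= phi x)%N) ->
  (forall x, (x < wdim w1)%N -> (phi x < wdim w2)%N -> wvert w2 (phi x) = wvert w1 x) ->
  (forall x, (x < wdim w1)%N -> phi (wnext w1 x) = wnext w2 (phi x) \/
     (wdim w2 <= phi (wnext w1 x))%N /\ (wdim w2 <= wnext w2 (phi x))%N) ->
  walk_map w1 w2 phi \in hom (walk_mod w1) (walk_mod w2).
Proof.
move=> phi_out phi_vert phi_next; apply/hom_npathP => i s _.
have phi_iter x : (x < wdim w1)%N ->
   phi (iter s (wnext w1) x) = iter s (wnext w2) (phi x) \/
   (wdim w2 <= phi (iter s (wnext w1) x))%N /\ (wdim w2 <= iter s (wnext w2) (phi x))%N.
  move=> ltx; elim: s => [|s IH]; first by left.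
  rewrite !iterS; case: (ltnP (iter s (wnext w1) x) (wdim w1)) => [lt|ge].
    case: IH => [eq12|[out1 out2]]; first by rewrite -eq12; apply: phi_next.
    right; split; last exact: wnext_out.
    case: (phi_next _ lt) => [->|[]//]; exact: wnext_out.
  right; split; first by apply: phi_out; apply: wnext_out.
  apply: wnext_out; case: IH => [<-|[]//]; exact: phi_out.
apply/matrixP => p q; rewrite !mxE.
have nq x : (wdim w2 <= x)%N -> (x == q) = false.
  by move=> ge; rewrite gtn_eqF // (leq_trans (ltn_ord q)).
transitivity (((wvert w1 p == i) && (phi (iter s (wnext w1) p) == q))%:R : K).
  case: (ltnP (iter s (wnext w1) p) (wdim w1)) => [lt|ge].
    rewrite (bigD1 (Ordinal lt)) //= big1 ?addr0 => [|r].
      by rewrite walk_mod_npath mxE eqxx andbT -natrM mulnb.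
    by rewrite -val_eqE /= eq_sym walk_mod_npath => /negPf->; rewrite andbF mul0r.
  rewrite nq ?phi_out // andbF big1 // => r _.
  by rewrite walk_mod_npath gtn_eqF ?andbF ?mul0r // (leq_trans (ltn_ord r)).
have eq_iter : (phi (iter s (wnext w1) p) == q) = (iter s (wnext w2) (phi p) == q).
  by case: (phi_iter p (ltn_ord p)) => [->//|[o1 o2]]; rewrite !nq.
rewrite eq_iter; case: (ltnP (phi p) (wdim w2)) => [lt|ge].
  rewrite (bigD1 (Ordinal lt)) //= big1 ?addr0 => [|r].
    by rewrite walk_mod_npath mxE eqxx mul1r phi_vert.
  by rewrite -val_eqE /= eq_sym mxE => /negPf->; rewrite mul0r.
rewrite nq ?iter_out // andbF big1 // => r _.
by rewrite mxE gtn_eqF ?mul0r // (leq_trans (ltn_ord r)).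
Qed.

(** * Uniserial modules and their homomorphisms *)

(** The length of the shortest path from [i] to [j]. *)
Definition steps i j : nat := (j - i)%R.

Lemma vert_eq i j q : (q < N)%N -> (i + q%:R == j) = (q == steps i j :> nat)%N.
Proof.
by move=> ltq; rewrite eq_sym [i + _]addrC -subr_eq eq_sym -val_eqE /= val_Zp_nat // modn_small.
Qed.

Lemma inord0 k : inord 0 = 0 :> 'I_k.+1.
Proof. by apply: val_inj; rewrite /= inordK. Qed.

Lemma stepsxx i : steps i i = 0%N.
Proof. by rewrite /steps subrr. Qed.

Implicit Types (a b c : 'Z_N * 'I_N).

Lemma uniserial_next_vert i x : i + x.+1%:R = i + x%:R + 1 :> 'Z_N.
Proof. by rewrite -addrA -natr1. Qed.

Lemma uniserial_next_nil (l : 'I_N) x : (l.+1 <= iter N succn x)%N.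
Proof. by rewrite iter_succn (leq_trans (ltn_ord l)) ?leq_addl. Qed.

(** The code [(i, l)] stands for the module with top [S_i] and length [l + 1]. *)
Definition uniserial_walk c : walk :=
  @Walk c.2.+1 succn (fun x => c.1 + x%:R) (fun x => @leqW _ x)
    (fun x _ _ => uniserial_next_vert c.1 x) (uniserial_next_nil c.2).

Definition uniserial c : fdmod A := walk_mod (uniserial_walk c).
Local Arguments uniserial : simpl never.

Lemma uniserial_lt c (q : 'I_c.2.+1) : (q < N)%N.
Proof. exact: leq_trans (ltn_ord q) (ltn_ord c.2). Qed.

Lemma uniserial_npath c i s (p q : 'I_c.2.+1) :
  uniserial c (npath i s) p q = ((c.1 + p%:R == i) && (p + s == q)%N)%:R.
Proof. by rewrite walk_mod_npath /= iter_succn. Qed.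

Lemma uniserial_row c i s (y : 'rV[K]_c.2.+1) (q : 'I_c.2.+1) :
  (y *m uniserial c (npath i s)) 0 q =
  if ((s <= q)%N && (c.1 + (q - s)%:R == i)) then y 0 (inord (q - s)) else 0.
Proof.
rewrite mxE; case: leqP => [le|lt] /=.
  have lt : (q - s < c.2.+1)%N by rewrite (leq_ltn_trans _ (ltn_ord q)) ?leq_subr.
  rewrite (bigD1 (inord (q - s))) //= big1 ?addr0 => [|r].
    by rewrite uniserial_npath inordK // subnK // eqxx andbT; case: eqP; rewrite ?mulr1 ?mulr0.
  rewrite -val_eqE /= inordK // uniserial_npath => neq.
  rewrite (_ : (r + s == q)%N = false) ?andbF ?mulr0 //; apply: contraNF neq.
  by move=> /eqP <-; rewrite addnK.
rewrite big1 // => r _; rewrite uniserial_npath gtn_eqF ?andbF ?mulr0 //.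
by rewrite (leq_trans lt) ?leq_addl.
Qed.

Lemma uniserial_delta c (p : 'I_c.2.+1) i s : delta_mx 0 p *m uniserial c (npath i s) =
  if (c.1 + p%:R == i) && (p + s <= c.2)%N then delta_mx 0 (inord (p + s)) else 0
  :> 'rV[K]_c.2.+1.
Proof.
apply/rowP => q; rewrite -rowE mxE uniserial_npath; case: eqP => _ /=; last by rewrite mxE.
case: leqP => [le|lt]; first by rewrite mxE eqxx -(val_eqE q) /= inordK // eq_sym.
by rewrite gtn_eqF ?mxE // (leq_trans (@ltn_ord c.2.+1 q)).
Qed.

Lemma uniserial_top c s : delta_mx 0 0 *m uniserial c (npath c.1 s) =
  if (s <= c.2)%N then delta_mx 0 (inord s) else 0 :> 'rV[K]_c.2.+1.
Proof. by rewrite uniserial_delta addr0 eqxx. Qed.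

Section Yoneda.
Variables (c : 'Z_N * 'I_N) (E : fdmod A).

Lemma hom_uniserial_row (X : 'M_(fddim (uniserial c), fddim E)) (p : 'I_c.2.+1) :
  X \in hom (uniserial c) E -> row p X = row 0 X *m E (npath c.1 p).
Proof.
move=> /hom_npathP/(_ c.1 p) h.
rewrite -row_mul -h; last exact: uniserial_lt.
by rewrite !rowE mulmxA uniserial_top leq_ord inord_val.
Qed.

Lemma hom_top_inj (X Y : 'M_(fddim (uniserial c), fddim E)) :
  X \in hom (uniserial c) E -> Y \in hom (uniserial c) E -> row 0 X = row 0 Y -> X = Y.
Proof.
by move=> hX hY eq0; apply/row_matrixP => p; rewrite (hom_uniserial_row p hX) (hom_uniserial_row p hY) eq0.
Qed.

Lemma hom_uniserial_top (X : 'M_(fddim (uniserial c), fddim E)) s : X \in hom (uniserial c) E ->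
  row 0 X *m E (npath c.1 s) = (delta_mx 0 0 *m uniserial c (npath c.1 s)) *m X.
Proof. by move=> /homP h; rewrite rowE -!mulmxA h. Qed.

(** The module of code [(i, l)] is the quotient of [e_i Lambda] by the paths of length
    more than [l], so that a homomorphism from it amounts to an element killed by
    these paths, namely the image of the top. *)
Lemma hom_from_top (y : 'rV_(fddim E)) :
  y *m E (npath c.1 0) = y -> y *m E (npath c.1 c.2.+1) = 0 ->
  exists2 X : 'M_(fddim (uniserial c), fddim E), X \in hom (uniserial c) E & row 0 X = y.
Proof.
move=> y0 yc; pose X : 'M_(fddim (uniserial c), fddim E) := \matrix_(p < c.2.+1) (y *m E (npath c.1 p)).
exists X; last by rewrite rowK.
have ys s : (c.2.+1 <= s)%N -> y *m E (npath c.1 s) = 0.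
  move=> le; have := act_npath_mul E c.1 c.2.+1 (c.1 + c.2.+1%:R) (s - c.2.+1).
  by rewrite eqxx subnKC // => <-; rewrite mulmxA yc mul0mx.
apply/hom_npathP => i s _; apply/row_matrixP => p.
rewrite !row_mul rowK -mulmxA act_npath_mul eq_sym.
have -> : row p (uniserial c (npath i s)) *m X =
  if c.1 + p%:R == i then y *m E (npath c.1 (p + s)) else 0.
  case: ifP => eqi.
    have [le|lt] := leqP (p + s) c.2.
      have -> : row p (uniserial c (npath i s)) = delta_mx 0 (inord (p + s)).
        by apply/rowP => q; rewrite [LHS]mxE uniserial_npath [RHS]mxE eqi eqxx -(val_eqE q) /= inordK // eq_sym.
      by rewrite -rowE rowK inordK.
    rewrite ys // (_ : row _ _ = 0) ?mul0mx //; apply/rowP => q.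
    by rewrite mxE uniserial_npath gtn_eqF ?andbF ?mxE // (leq_trans _ lt).
  rewrite (_ : row _ _ = 0) ?mul0mx //; apply/rowP => q.
  by rewrite mxE uniserial_npath eqi mxE.
by rewrite eq_sym; case: ifP => //; rewrite mulmx0.
Qed.
End Yoneda.

(** Nonvanishing of the homomorphisms from [b] to [a].  With [t] the number of steps
    from the top of [a] to that of [b], such a homomorphism maps the top of [b] to a
    multiple of the basis vector [t] of [a]; this vector must exist and be killed by
    the path of length [b.2 + 1]. *)
Definition hom_uniserial_neq0 a b : bool :=
  (steps a.1 b.1 <= a.2 <= steps a.1 b.1 + b.2)%N.

Lemma uniserial_vertex_coord a (y : 'rV[K]_a.2.+1) j q : y *m uniserial a (npath j 0) = y ->
  y 0 q != 0 -> q = steps a.1 j :> nat.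
Proof.
move=> <-; rewrite uniserial_row /= subn0; case: ifP => [|_]; last by rewrite eqxx.
rewrite vert_eq => [/eqP//|]; exact: uniserial_lt.
Qed.

Lemma hom_uniserial0 a b : ~~ hom_uniserial_neq0 a b -> hom (uniserial b) (uniserial a) = 0%VS.
Proof.
rewrite /hom_uniserial_neq0; set t := steps _ _ => cond.
apply/eqP; rewrite -subv0; apply/subvP => X hX; rewrite memv0; apply/eqP.
have h0 : (0 : 'M_(fddim (uniserial b), fddim (uniserial a))) \in hom (uniserial b) (uniserial a) by exact: mem0v.
apply: (@hom_top_inj b (uniserial a) X 0 hX h0); rewrite row0.
have := hom_uniserial_top 0 hX; rewrite uniserial_top -rowE inord0 /= => top0.
have := hom_uniserial_top b.2.+1 hX; rewrite uniserial_top ltnn mul0mx => topb.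
apply/rowP => q; rewrite [RHS]mxE; apply/eqP/negPn/negP => nz.
have qt := uniserial_vertex_coord top0 nz.
have lel : (t <= a.2)%N by rewrite /t -qt -ltnS.
have ltm : (t + b.2 < a.2)%N by rewrite lel -ltnNge in cond.
have /rowP/(_ (inord (t + b.2.+1))) := topb; rewrite uniserial_row inordK; last by rewrite addnS.
rewrite leq_addl addnK vert_eq ?eqxx; last by rewrite (leq_ltn_trans lel).
by rewrite [t](esym qt) inord_val [RHS]mxE => e; rewrite e eqxx in nz.
Qed.

Lemma hom_uniserialN0 a b : hom_uniserial_neq0 a b -> hom (uniserial b) (uniserial a) <> 0%VS.
Proof.
rewrite /hom_uniserial_neq0; set t := steps _ _ => /andP[lel lem].
have ltN : (t < N)%N by rewrite (leq_ltn_trans lel).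
pose y : 'rV[K]_a.2.+1 := delta_mx 0 (inord t).
have yt : a.1 + (inord t : 'I_a.2.+1)%:R == b.1 by rewrite inordK // vert_eq.
have [||X hX X0 h0] := @hom_from_top b (uniserial a) y.
- by rewrite uniserial_delta yt inordK // addn0 lel.
- by rewrite uniserial_delta yt inordK // addnS ltnNge lem.
have := hX; rewrite h0 memv0 => /eqP X00.
have /rowP/(_ (inord t)) := X0; rewrite X00 row0 !mxE !eqxx => /eqP.
by rewrite eq_sym oner_eq0.
Qed.

Lemma brick_uniserial a : \dim (hom (uniserial a) (uniserial a)) = 1%N.
Proof.
suff -> : hom (uniserial a) (uniserial a) = <[1%:M : 'M[K]_a.2.+1]>%VS.
  by rewrite dim_vline matrix_nonzero1.
apply/eqP; rewrite eqEsubv -memvE hom_id andbT; apply/subvP => X hX.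
apply/vlineP; exists (X 0 0); apply: (hom_top_inj hX); first by rewrite memvZ ?hom_id.
have := hom_uniserial_top 0 hX; rewrite uniserial_top -rowE inord0 /= => top0.
apply/rowP => q; have [/eqP q0|nz] := boolP (row 0 X 0 q == 0).
  rewrite q0 !mxE; case: eqP => [e|]; rewrite ?mulr0 // mulr1.
  by move: q0; rewrite mxE e.
have := uniserial_vertex_coord top0 nz; rewrite stepsxx => q0.
have -> : q = 0 by apply: val_inj.
by rewrite !mxE eqxx mulr1.
Qed.

(** * Extensions of uniserial modules *)

(** Nonvanishing of the extensions of [b] by [a].  The path of length [b.2 + 1] from
    the top of [b], zero in [b], ends at the vertex of the basis vector
    [u = t + b.2 + 1 - N] of [a].  The first two conditions say that [u] is at least
    zero and at most [a.2]; the third one that [a] vanishes at the top vertex of [b]. *)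
Definition ext_uniserial_neq0 a b : bool :=
  [&& (N <= steps a.1 b.1 + b.2.+1)%N, (steps a.1 b.1 + b.2.+1 < a.2.+1 + N)%N
    & (a.2 < steps a.1 b.1)%N].

(** Lift the top of [b] to an element [w] of the extension at the same vertex.  Then
    [w] times the path of length [b.2 + 1] comes from an element [z] of [a], and a
    section exists as soon as [z] is the image under this path of some [y], to be
    subtracted from [w].  If [z] is nonzero, it is a multiple of a basis vector [q]
    with [q = t + b.2 + 1] or [q + N = t + b.2 + 1].  In the former case [y] is the
    multiple of the basis vector [t].  In the latter one, [z] is killed by the path
    of length [N - b.2 - 1], because paths of length [N] vanish; this forces
    [a.2 < t] and leads to the excluded case. *)
Lemma ext_uniserial0 a b : ~~ ext_uniserial_neq0 a b -> ext1_eq0 (uniserial b) (uniserial a).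
Proof.
rewrite /ext_uniserial_neq0; set t := steps _ _ => cond E f g [hf hg ff fg /eqmxP efg].
have fg0 : f *m g = 0 by apply: sub_kermxP; rewrite efg.
have ltm : (b.2.+1 <= N)%N := ltn_ord b.2.
have ltt : (t < N)%N := ltn_ord (b.1 - a.1).
have /submxP[w0 w0g] : ((delta_mx 0 0 : 'rV_(fddim (uniserial b))) <= g)%MS by rewrite submx_full.
pose w := w0 *m E (npath b.1 0).
have wg : w *m g = delta_mx 0 0.
  by rewrite -mulmxA (hom_mul _ hg) mulmxA -w0g uniserial_top inord0.
have w1 : w *m E (npath b.1 0) = w.
  by rewrite -mulmxA act_npath_mul addr0 eqxx.
have : (w *m E (npath b.1 b.2.+1) <= f)%MS.
  rewrite efg; apply/sub_kermxP.
  by rewrite -mulmxA (hom_mul _ hg) mulmxA wg uniserial_top ltnn.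
case/submxP=> z wz.
have zs s : z *m uniserial a (npath (b.1 + b.2.+1%:R) s) *m f = w *m E (npath b.1 (b.2.+1 + s)).
  by rewrite -mulmxA (hom_mul _ hf) mulmxA -wz -mulmxA act_npath_mul eqxx.
have z0 : z *m uniserial a (npath (b.1 + b.2.+1%:R) 0) = z.
  by apply: (row_free_inj ff); rewrite zs addn0.
have zN : z *m uniserial a (npath (b.1 + b.2.+1%:R) (N - b.2.+1)) = 0.
  apply: (row_free_inj ff); rewrite zs subnKC // (npath_eq0 _ (leqnn N)) raddf0.
  by rewrite mulmx0 mul0mx.
suff [y y0 ym] : exists2 y, y *m uniserial a (npath b.1 0) = y & y *m uniserial a (npath b.1 b.2.+1) = z.
  have [||h hh h0] := @hom_from_top b E (w - y *m f).
  - by rewrite mulmxBl w1 -mulmxA -(hom_mul _ hf) mulmxA y0.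
  - by rewrite mulmxBl wz -[y *m f *m _]mulmxA -(hom_mul _ hf) mulmxA ym subrr.
  exists h => //; apply: (@hom_top_inj b (uniserial b)); [exact: hom_comp hg|exact: hom_id|].
  by rewrite row_mul h0 mulmxBl wg -mulmxA fg0 mulmx0 subr0 rowE mulmx1.
have [->|/rV0Pn[q nz]] := eqVneq z 0; first by exists 0; rewrite !mul0mx.
have qE : (a.1 + q%:R == b.1 + b.2.+1%:R).
  by rewrite vert_eq; [exact/eqP/(uniserial_vertex_coord z0 nz)|exact: (@uniserial_lt a q)].
have ltq : (q < a.2.+1)%N := @ltn_ord a.2.+1 q.
(* Otherwise the path of length N - b.2 - 1 would not kill the basis vector q. *)
have qN : (a.2 < q + (N - b.2.+1))%N.
  rewrite ltnNge; apply: contra nz => le.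
  have /rowP/(_ (inord (q + (N - b.2.+1)))) := zN.
  by rewrite uniserial_row inordK // leq_addl addnK qE inord_val [RHS]mxE => /eqP.
have modq : (q = t + b.2.+1 :> nat \/ q + N = t + b.2.+1)%N.
  have : (a.1 + q%:R == a.1 + (t + b.2.+1)%:R).
    by rewrite (eqP qE) natrD addrA; apply/eqP; congr (_ + _); apply/esym/eqP; rewrite vert_eq.
  rewrite (inj_eq (addrI _)) -val_eqE /= !val_Zp_nat // => /eqP.
  rewrite modn_small; last exact: (@uniserial_lt a q).
  have [lt|ge] := ltnP (t + b.2.+1) N; first by rewrite modn_small //; left.
  rewrite -[in X in _ = X](subnK ge) modnDr modn_small; last by lia.
  by move=> ->; right; rewrite subnK.
case: modq => [qt|qt]; last by move: cond; lia.
have zE : z = z 0 q *: delta_mx 0 q.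
  apply/rowP => q'; rewrite !mxE; have [->|neq] := eqVneq q' q; first by rewrite mulr1.
  rewrite mulr0; apply/eqP/negPn/negP => nz'; case/eqP: neq; apply: val_inj.
  by rewrite /= (uniserial_vertex_coord z0 nz') (uniserial_vertex_coord z0 nz).
have lt_t : (t < a.2.+1)%N by lia.
have yt : a.1 + (inord t : 'I_a.2.+1)%:R == b.1 by rewrite inordK // vert_eq.
exists (z 0 q *: delta_mx 0 (inord t)).
  by rewrite -scalemxAl uniserial_delta yt inordK // addn0 -ltnS lt_t.
rewrite -scalemxAl uniserial_delta yt inordK // -qt -ltnS ltq inord_val.
by rewrite -zE.
Qed.

Section Glue.
Variables (a b : 'Z_N * 'I_N).
Local Notation t := (steps a.1 b.1).
Local Notation l := (a.2 : nat).
Local Notation m := (b.2 : nat).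
Hypothesis ext_ab : ext_uniserial_neq0 a b.
Local Notation u := (t + m.+1 - N)%N.
Local Notation d := (l.+1 + m.+1)%N.

(** The nonsplit extension: the basis of [a] followed by that of [b], where the last
    vector of [b] is sent to the basis vector [u] of [a] instead of zero. *)
Definition glue_next x := if (x == l) then d else if (x == l.+1 + m)%N then u else x.+1.
Definition glue_vert x : 'Z_N := if (x <= l)%N then a.1 + x%:R else b.1 + (x - l.+1)%:R.

Fact glue_nextS x : x != l -> (x != l.+1 + m)%N -> glue_next x = x.+1.
Proof. by rewrite /glue_next => /negPf -> /negPf ->. Qed.

Fact glue_out x : (d <= x)%N -> (d <= glue_next x)%N.
Proof. by rewrite /glue_next; do 2?case: eqP; lia. Qed.

Fact glue_u : (u <= l)%N.
Proof. by move: ext_ab; rewrite /ext_uniserial_neq0; lia. Qed.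

Fact glue_vert_next x : (x < d)%N -> (glue_next x < d)%N ->
  glue_vert (glue_next x) = glue_vert x + 1.
Proof.
rewrite /glue_next; case: eqP => [_|xl]; first by rewrite ltnn.
case: eqP => [-> _ _|xlm ltx ltx1].
  rewrite /glue_vert glue_u (_ : (l.+1 + m <= l)%N = false); last by lia.
  rewrite addKn; have /andP[le _] := ext_ab.
  have /eqP e : a.1 + t%:R == b.1 by rewrite vert_eq // ltn_ord.
  rewrite -[X in _ = X + _ + _]e -!addrA natr1 -natrD; congr (_ + _).
  apply: val_inj; rewrite /= !val_Zp_nat //.
  by rewrite -[in RHS](subnK le) modnDr.
rewrite /glue_vert; have -> : (x < l)%N = (x <= l)%N by lia.
by case: leqP => lt; rewrite -addrA natr1 // subSn.
Qed.

(** The number of steps from [x < d] to zero.  It is at most [N] because [l < t]. *)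
Definition glue_height x : nat := (if x <= l then l.+1 - x else d - x + (l.+1 - u))%N.

Fact glue_nil x : (d <= iter N glue_next x)%N.
Proof.
have le : (0 < glue_height x <= N)%N \/ (d <= x)%N.
  by have := ltn_ord a.2; move: ext_ab; rewrite /glue_height /ext_uniserial_neq0; case: (leqP x l); lia.
have out k y : (d <= y)%N -> (d <= iter k glue_next y)%N.
  by move=> dy; elim: k => //= k; apply: glue_out.
case: le => [/andP[h0 hN]|]; last exact: out.
have step k : (d <= iter k glue_next x)%N \/
    (0 < glue_height (iter k glue_next x))%N /\ (glue_height (iter k glue_next x) + k <= N)%N.
  elim: k => [|k []]; first by right; rewrite addn0.
    by move/glue_out; left.
  rewrite iterS; move: (iter k _ x) => y [y0 yN].
  move: glue_u y0 yN; rewrite /glue_height /glue_next.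
  by do 4?case: ifP; lia.
by case: (step N) => // -[]; lia.
Qed.

Definition glue_walk : walk := Walk glue_out glue_vert_next glue_nil.
Definition glue : fdmod A := walk_mod glue_walk.
Local Arguments glue : simpl never.

Definition glue_sub : 'M[K]_(l.+1, d) := row_mx 1%:M 0.
Definition glue_quo : 'M[K]_(d, m.+1) := col_mx 0 1%:M.

Lemma glue_exact : @short_exact _ _ (uniserial a) glue (uniserial b) glue_sub glue_quo.
Proof.
split.
- have -> : glue_sub = @walk_map (uniserial_walk a) glue_walk (fun x => if (x <= l)%N then x else d + x)%N.
    apply/matrixP => p q; rewrite /glue_sub !mxE (_ : (p <= l)%N); last by rewrite -ltnS ltn_ord.
    by case: split_ordP => r ->; rewrite !mxE /= -?val_eqE //= ltn_eqF // (leq_trans (ltn_ord p)) ?leq_addr.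
  apply: walk_hom => x /=.
  + by rewrite ltnNge => /negPf ->; rewrite leq_addr.
  + by rewrite ltnS => lex _; rewrite lex /glue_vert lex.
  + rewrite ltnS => lex; rewrite lex /glue_next; case: eqP => [->|ne].
      by right; rewrite ltnn leq_addr leqnn.
    have -> : (x == l.+1 + m)%N = false by clear -lex; lia.
    by have -> : (x < l)%N by [clear -lex ne; lia]; left.
- have -> : glue_quo = @walk_map glue_walk (uniserial_walk b) (fun x => if (x <= l)%N then m.+1 else x - l.+1)%N.
    apply/matrixP => p q; rewrite /glue_quo !mxE.
    case: split_ordP => r ->; rewrite !mxE /=.
      by rewrite -ltnS ltn_ord gtn_eqF.
    by rewrite -ltnS ltnNge leq_addr /= addKn.
  apply: walk_hom => x /=.
  + by case: (leqP x l); lia.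
  + by rewrite /glue_vert; case: (leqP x l); rewrite ?ltnn.
  + move: glue_u => ul ltx; rewrite /glue_next; case: (leqP x l) => lx.
      by right; split=> //; case: eqP => //; do ?case: ifP; lia.
    rewrite (_ : (x == l) = false); last by lia.
    case: eqP => [->|ne]; first by right; rewrite ul; split=> //; lia.
    by left; rewrite leqNgt ltnW // subSn.
- apply/row_freeP; exists (col_mx 1%:M 0); by rewrite mul_row_col mulmx1 mul0mx addr0.
- apply/row_fullP; exists (row_mx 0 1%:M); by rewrite mul_row_col mulmx1 mulmx0 add0r.
apply/andP; split; first by apply/sub_kermxP; rewrite mul_row_col mulmx0 mul0mx addr0.
have := mulmx_ker glue_quo; rewrite -[kermx _]hsubmxK mul_row_col mulmx0 mulmx1 add0r => ->.
by apply/submxP; exists (lsubmx (kermx glue_quo)); rewrite mul_mx_row mulmx1 mulmx0.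
Qed.

Lemma glue_npath i s (p q : 'I_d) :
  glue (npath i s) p q = ((glue_vert p == i) && (iter s glue_next p == q))%:R.
Proof. exact: walk_mod_npath. Qed.

(** As [a] vanishes at the top vertex of [b], a section maps the top of [b] to the
    corresponding basis vector of the extension.  The path of length [b.2 + 1] kills
    the top of [b] but sends this vector to the basis vector [u] of [a]. *)
Lemma ext_uniserialN0 : ~ ext1_eq0 (uniserial b) (uniserial a).
Proof.
move=> /(_ _ _ _ glue_exact)[h hh hg].
pose w : 'rV_d := row 0 h.
have w0 : w *m glue (npath b.1 0) = w.
  by rewrite /w (hom_uniserial_top _ hh) uniserial_top inord0 -rowE.
have wg : w *m glue_quo = delta_mx 0 0 by rewrite -row_mul hg rowE mulmx1.
have lt_t : (l < t)%N by case/and3P: ext_ab.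
have wE : w = delta_mx 0 (rshift l.+1 0).
  rewrite -[LHS]hsubmxK delta_mx_rshift; congr row_mx; last first.
    by move: wg; rewrite -[w in LHS]hsubmxK mul_row_col mulmx0 mulmx1 add0r.
  apply/rowP => p; rewrite mxE -w0 mxE [RHS]mxE big1 // => x _; rewrite glue_npath.
  case: (eqVneq (x : nat) p) => [->|]; last by rewrite andbF mulr0.
  rewrite andbT /glue_vert -ltnS ltn_ord vert_eq; last exact: uniserial_lt.
  by rewrite ltn_eqF ?mulr0 // (leq_trans (ltn_ord p)).
have ul := glue_u.
have := hom_uniserial_top m.+1 hh; rewrite uniserial_top ltnn mul0mx.
rewrite -/w wE -rowE => /rowP/(_ (lshift _ (inord u))).
rewrite mxE glue_npath [RHS]mxE /= addn0 inordK //.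
have it k : (k <= m)%N -> iter k glue_next l.+1 = (l.+1 + k)%N.
  elim: k => [|k IH] km; first by rewrite addn0.
  rewrite iterS IH; last exact: ltnW.
  by rewrite glue_nextS ?addnS // neq_ltn ?eqn_add2l ?ltn_add2l ?km ?leq_addr ?orbT.
rewrite it // /glue_vert ltnn subnn addr0 eqxx /glue_next eqxx.
rewrite ifF; last by lia.
by rewrite eqxx => /eqP; rewrite oner_eq0.
Qed.
End Glue.

(** * Bricks are uniserial *)

(** Let [l] be maximal such that some path [p] of length [l], say from [i], acts
    nontrivially, and let [v] be an element with [v p] nonzero.  Then [v] generates a
    submodule isomorphic to that of code [(i, l)].  A linear form [phi] with
    [phi (v p) = 1] defines a retraction [Q] onto it: the coefficient of [Q z] at the
    basis vector [t] is the value of [phi] on [z] times the path of length [l - t]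
    from the vertex of [t] on.  The composite of [Q] with the inclusion is an
    endomorphism, hence a scalar, and this scalar is [1]. *)
Lemma brick_iso_uniserial M : \dim (hom M M) = 1%N -> exists c, fdmod_iso M (uniserial c).
Proof.
move=> dim1; have d0 : (0 < fddim M)%N.
  rewrite lt0n; apply/eqP => d0; have := dimvS (subvf (hom M M)).
  by rewrite dim1 dimvf /dim /= d0.
pose P l := [exists i : 'Z_N, M (npath i l) != 0].
have P0 : P 0%N.
  apply/existsP/not_existsP => all0; have := rmorph1 M.
  rewrite npath_one raddf_sum big1 => [|i _]; last by apply/eqP/negPn/negP/all0.
  move/esym/eqP; apply/negP; case: (fddim M) d0 => // d _; exact: matrix_nonzero1.
have Plt l : P l -> (l <= n'.+1)%N.
  by case/existsP => i; rewrite leqNgt; apply: contra => le; rewrite npath_eq0 // raddf0.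
case: (ex_maxnP (ex_intro P 0%N P0) Plt) => l /existsP[i nz] maxl.
have pathl h s : (l < s)%N -> M (npath h s) = 0.
  move=> lts; apply/eqP/negPn/negP => ne.
  have : P s by apply/existsP; exists h.
  by move/maxl; rewrite leqNgt lts.
have ltl : (l < N)%N by rewrite ltnS Plt //; apply/existsP; exists i.
pose c : 'Z_N * 'I_N := (i, Ordinal ltl).
have /matrix0Pn[x [y nxy]] := nz.
pose v := row x (M (npath i 0)).
have vs s : v *m M (npath i s) = row x (M (npath i s)).
  by rewrite -row_mul act_npath_mul addr0 eqxx.
have [||H hH H0] := @hom_from_top c M v; rewrite ?vs //.
  by rewrite pathl ?row0 //=.
have Hs (s : 'I_l.+1) : row s H = row x (M (npath i s)).
  by rewrite (@hom_uniserial_row c M H s hH) H0 vs.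
pose phi : 'cV[K]_(fddim M) := (M (npath i l) x y)^-1 *: delta_mx y 0.
pose Q : 'M[K]_(fddim M, l.+1) := \matrix_(z, t) (M (npath (i + t%:R) (l - t)) *m phi) z 0.
have Qt (t : 'I_l.+1) : col t Q = M (npath (i + t%:R) (l - t)) *m phi.
  by apply/colP => z; rewrite mxE [LHS]mxE.
have HQ : H *m Q = 1%:M.
  apply/matrixP => s t.
  have -> : (H *m Q) s t = (row s H *m col t Q) 0 0.
    by rewrite [in RHS]colE mulmxA -colE -row_mul [RHS]mxE [RHS]mxE.
  rewrite Hs Qt mulmxA -row_mul act_npath_mul (inj_eq (addrI i)).
  have -> : ((t : nat)%:R == (s : nat)%:R :> 'Z_N) = (t == s).
    by rewrite -val_eqE /= !val_Zp_nat // !modn_small // (@uniserial_lt c).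
  rewrite [RHS]mxE eq_sym; case: eqVneq => [->|ne]; last by rewrite row0 mul0mx mxE.
  rewrite subnKC; last by rewrite -ltnS.
  by rewrite -scalemxAr -colE mxE mxE mxE mulVf.
have hQ : Q \in hom M (uniserial c).
  apply/hom_npathP => h s _; apply/matrixP => z t.
  have -> : (M (npath h s) *m Q) z t = (M (npath h s) *m col t Q) z 0.
    by rewrite [in RHS]colE mulmxA -colE [RHS]mxE.
  have -> : (Q *m uniserial c (npath h s)) z t = (row z Q *m uniserial c (npath h s)) 0 t.
    by rewrite -row_mul [RHS]mxE.
  rewrite uniserial_row Qt mulmxA act_npath_mul /=; case: leqP => [le|lt] /=; last first.
    by case: ifP; rewrite ?pathl ?mul0mx ?mxE //; lia.
  have -> : (i + (t : nat)%:R == h + s%:R) = (i + (t - s)%:R == h).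
    by rewrite -[in LHS](subnK le) natrD addrA (inj_eq (addIr _)).
  have ltt := @ltn_ord l.+1 t.
  case: eqP => [<-|_]; last by rewrite mul0mx mxE.
  rewrite [RHS]mxE [RHS]mxE inordK; last by rewrite (leq_ltn_trans (leq_subr _ _)).
  by congr ((M (npath _ _) *m _) _ _); lia.
have [e QH] := brick_scalar dim1 d0 (hom_comp hQ hH).
have e1 : e = 1.
  have : H *m Q *m H *m Q = e%:M by rewrite -(mulmxA H) QH mul_mx_scalar -scalemxAl HQ scalemx1.
  by rewrite HQ mul1mx HQ => /matrixP/(_ 0 0); rewrite !mxE.
by exists c, Q, H; split=> //; rewrite QH e1.
Qed.

(** The path of length [c.2] from [c.1] acts nontrivially on the module of code [c],
    hence on any isomorphic one.  This compares the lengths, and for equal lengths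
    the tops. *)
Lemma uniserial_inj a b : fdmod_iso (uniserial a) (uniserial b) -> a = b.
Proof.
have key c d : fdmod_iso (uniserial c) (uniserial d) -> c = d \/ (c.2 < d.2)%N.
  move=> cd; have [X [Y [hX hY XY YX]]] := cd.
  have nz : uniserial d (npath c.1 c.2) != 0.
    apply: contraTneq (oner_neq0 K) => d0.
    have := uniserial_top c c.2; rewrite leqnn.
    have -> : uniserial c (npath c.1 c.2) = 0.
      by rewrite -[LHS]mulmx1 -XY mulmxA (hom_mul _ hX) d0 mulmx0 mul0mx.
    by rewrite mulmx0 => /rowP/(_ (inord c.2)); rewrite !mxE !eqxx => /esym/eqP; rewrite negbK.
  have /matrix0Pn[p [q]] := nz; rewrite uniserial_npath; case: andP => [[/eqP e1 /eqP e2] _|_]; last by rewrite eqxx.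
  have ltq := @ltn_ord d.2.+1 q; have le : (c.2 <= d.2)%N by lia.
  case: (ssrnat.ltngtP c.2 d.2) le => // [lt|eq2] _; [by right|left].
  have p0 : p = 0%N :> nat by apply/eqP; rewrite -leqn0 -(leq_add2r c.2) e2 eq2 -ltnS.
  move: e1; rewrite p0 addr0; case: (c) (d) eq2 => [c1 c2] [d1 d2] /= /ord_inj -> -> //.
move=> ab; case: (key _ _ ab) => // lt1; case: (key _ _ (fdmod_iso_sym ab)) => // lt2.
by have := ltn_trans lt1 lt2; rewrite ltnn.
Qed.

Definition wep_code a b : bool := ~~ hom_uniserial_neq0 a b && ~~ ext_uniserial_neq0 a b.

Lemma weak_exceptional_uniserial a : weak_exceptional (uniserial a).
Proof.
split; first exact: brick_uniserial.
apply: ext_uniserial0; rewrite /ext_uniserial_neq0 stepsxx; lia.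
Qed.

Lemma wep_codeP a b : reflect (weak_exceptional_pair (uniserial a) (uniserial b)) (wep_code a b).
Proof.
apply: (iffP andP) => [[h e]|[_ _ h e]].
  split; [exact: weak_exceptional_uniserial|exact: weak_exceptional_uniserial| |].
    exact: hom_uniserial0.
  exact: ext_uniserial0.
by split; apply/negP; [move/hom_uniserialN0|move/ext_uniserialN0].
Qed.

Lemma wep_codexx a : wep_code a a = false.
Proof. by rewrite /wep_code /hom_uniserial_neq0 stepsxx add0n leqnn. Qed.
End Nakayama.

(** * From sequences of modules to families of arcs *)

Section Sequences.
Variables (K : fieldType) (n' : nat).
Local Notation N := n'.+2.
Local Notation A := (nakayama K N N).

Lemma stepsE (i j : 'Z_N) : steps i j = if (i <= j)%N then (j - i)%N else (j + N - i)%N.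
Proof.
have -> : steps i j = ((j + (N - i)) %% N)%N by rewrite /steps /= modnDmr.
have lti : (i < N)%N := ltn_ord i; have ltj : (j < N)%N := ltn_ord j.
move: (i : nat) (j : nat) lti ltj => {i j} i j lti ltj.
case: leqP => [le|lt].
  by rewrite (_ : (j + (N - i) = j - i + N)%N) ?modnDr ?modn_small //; lia.
by rewrite (_ : (j + (N - i) = j + N - i)%N) ?modn_small //; lia.
Qed.

(** The order of the sequence is encoded in the positions: each vertex of the cycle
    becomes [r] consecutive points, of which the [a]-th carries the arc of the [a]-th
    entry if it starts there.  With this convention the condition on a pair of
    entries becomes symmetric. *)
Definition start_pos r (s : 'I_r -> 'Z_N) (a : 'I_r) : nat := (r * s a + a)%N.

Section Positions.
Variables (r : nat) (c : 'I_r -> 'Z_N * 'I_N).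
Definition len (a : 'I_r) : nat := (c a).2.+1.
Local Notation pos := (start_pos (fun a => (c a).1)).

Lemma pos_lt a : (pos a < r * N)%N.
Proof.
have lt1 : ((c a).1 < N)%N := ltn_ord (c a).1.
have : (r * (c a).1.+1 <= r * N)%N by rewrite leq_mul2l lt1 orbT.
by rewrite /start_pos mulnS; have := ltn_ord a; lia.
Qed.

Lemma pos_inj a b : pos a = pos b %[mod r] -> a = b.
Proof.
by rewrite /start_pos ![(r * _)%N]mulnC !modnMDl !modn_small // => /ord_inj.
Qed.

Lemma gap_pos (a b : 'I_r) : (a < b)%N -> gap N pos a b = (r * steps (c a).1 (c b).1 + (b - a))%N.
Proof.
move=> ltab; rewrite /gap stepsE /start_pos; set i := (c a).1; set j := (c b).1.
have lti : (i < N)%N := ltn_ord i.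
have ltb := ltn_ord b.
case: (leqP i j) => leij.
  have h : (r * i <= r * j)%N by rewrite leq_mul2l leij orbT.
  rewrite (_ : (r * i + a <= r * j + b)%N) ?mulnBr; lia.
have h : (r * j + r <= r * i)%N by rewrite addnC -mulnS leq_mul2l leij orbT.
rewrite (_ : (r * i + a <= r * j + b)%N = false) ?mulnBr ?mulnDr; last by lia.
have : (r * i <= r * N)%N by rewrite leq_mul2l ltnW ?orbT.
lia.
Qed.

(** The distance from the start of [a] to that of [b] is [r * t + d] with
    [0 < d < r].  Hence comparing it with a multiple [r * q] amounts to comparing
    [t] with [q], strictly or not according to the side, and the conditions that the
    homomorphisms and the extensions from [b] to [a] vanish add up to [noncrossing]. *)
Lemma wep_noncrossing (a b : 'I_r) :
  (a < b)%N -> wep_code (c a) (c b) = noncrossing N pos len a b.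
Proof.
move=> ltab; rewrite /noncrossing gap_pos // /wep_code /hom_uniserial_neq0 /ext_uniserial_neq0 /len.
set t := steps _ _; have ltt : (t < N)%N := ltn_ord _.
have ltm : ((c b).2 < N)%N := ltn_ord _.
move: (nat_of_ord (c a).2) (nat_of_ord (c b).2) ltm => l m ltm.
have d0 : (0 < b - a)%N by rewrite subn_gt0.
have dr : (b - a < r)%N by rewrite (leq_ltn_trans (leq_subr _ _)).
move: (b - a)%N t ltt d0 dr => d t ltt d0 dr {ltab}; have r0 : (0 < r)%N by lia.
have lt_r p q : (r * p + d <= r * q)%N = (p < q)%N.
  case: (ltnP p q) => [lt|le].
    have : (r * p.+1 <= r * q)%N by rewrite leq_pmul2l.
    by rewrite mulnS; lia.
  have : (r * q <= r * p)%N by rewrite leq_pmul2l.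
  by move: (r * q)%N (r * p)%N => u v; lia.
have le_r p q : (r * q <= r * p + d)%N = (q <= p)%N.
  case: (leqP q p) => [le|lt].
    have : (r * q <= r * p)%N by rewrite leq_pmul2l.
    by move: (r * q)%N (r * p)%N => u v; lia.
  have : (r * p.+1 <= r * q)%N by rewrite leq_pmul2l.
  by rewrite mulnS; move: (r * q)%N (r * p)%N => u v; lia.
rewrite (_ : r * t + d + r * m.+1 = r * (t + m.+1) + d)%N; last by rewrite mulnDr addnAC.
by rewrite -mulnDr !lt_r !le_r; clear -ltt ltm; lia.
Qed.

Lemma wep_codes_noncrossing :
  (forall a b : 'I_r, (a < b)%N -> wep_code (c a) (c b)) <->
  (forall a b, a != b -> noncrossing N pos len a b).
Proof.
split=> [h a b neq_ab|h a b ltab]; last first.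
  by rewrite wep_noncrossing // h // -val_eqE /= ltn_eqF.
have := neq_ab; rewrite -val_eqE /= neq_ltn => /orP[lt|lt].
  by rewrite -wep_noncrossing // h.
rewrite (noncrossing_sym pos_lt pos_inj) // -wep_noncrossing //; exact: h.
Qed.
End Positions.

Definition class_seq r (c : 'I_r -> 'Z_N * 'I_N) : seq (set (fdmod A)) :=
  [seq iso_class (uniserial K (c i)) | i <- enum 'I_r].

(** Weak exceptional modules are bricks, so that only uniserial modules occur. *)
Lemma wesP (s : seq (set (fdmod A))) :
  wes A s <-> exists r (c : 'I_r -> 'Z_N * 'I_N),
    (forall a b : 'I_r, (a < b)%N -> wep_code (c a) (c b)) /\ s = class_seq c.
Proof.
split=> [[r [M [[wM pM] ->]]]|[r [c [hc ->]]]].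
  have /choice[c hc] : forall i, exists c, fdmod_iso (M i) (uniserial K c).
    by move=> i; apply: brick_iso_uniserial; case: (wM i).
  exists r, c; split=> [a b ltab|]; last by apply: eq_map => i; apply/iso_classE.
  have [_ _ h e] := pM _ _ ltab; apply/(wep_codeP K); split; do ?exact: weak_exceptional_uniserial.
    exact: hom0_iso (hc b) (hc a) h.
  exact: ext1_eq0_iso (hc b) (hc a) e.
exists r, (fun i => uniserial K (c i)); split=> //; split=> [i|i j ltij].
  exact: weak_exceptional_uniserial.
exact/wep_codeP/hc.
Qed.

Lemma class_seq_size r (c : 'I_r -> 'Z_N * 'I_N) :
  (forall a b : 'I_r, (a < b)%N -> wep_code (c a) (c b)) -> wes_size (class_seq c) = r.
Proof.
move=> hc; rewrite /wes_size /class_seq undup_id; first by rewrite size_map size_enum_ord.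
rewrite map_inj_uniq ?enum_uniq // => a b /iso_classE/uniserial_inj eqab.
apply/eqP/negPn/negP; rewrite -val_eqE /= neq_ltn => /orP[] /hc; rewrite eqab wep_codexx //.
Qed.

Lemma wes_size_leq s : wes A s -> (wes_size s <= N)%N.
Proof.
case/wesP => r [c [hc ->]]; rewrite class_seq_size //.
by apply: (noncrossing_leq (@pos_lt r c) (@pos_inj r c) _ _ ((wep_codes_noncrossing c).1 hc)) => // a; exact: ltn_ord.
Qed.

(** [park] gives the length of a module, while the second component of a code is the
    length minus one. *)
Definition park_code (s : {ffun 'I_N -> 'Z_N}) (i : 'I_N) : 'Z_N * 'I_N :=
  (s i, inord (park N (start_pos s) i).-1).

Lemma park_code_len s i : len (park_code s) i = park N (start_pos s) i.
Proof.
have p0 := park_gt0 N (start_pos s) i.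
have pN : (park N (start_pos s) i <= N)%N by exact: park_len.
by rewrite /len /= inordK prednK.
Qed.

Lemma wep_park_code s (a b : 'I_N) : (a < b)%N -> wep_code (park_code s a) (park_code s b).
Proof.
move: a b; apply/wep_codes_noncrossing => a b neq_ab.
have := @park_noncrossing _ _ _ (@pos_lt N (park_code s)) (@pos_inj N (park_code s)) erefl a b neq_ab.
by rewrite /noncrossing !park_code_len.
Qed.

Lemma wep_park_code_unique (c : 'I_N -> 'Z_N * 'I_N) :
  (forall a b : 'I_N, (a < b)%N -> wep_code (c a) (c b)) ->
  c =1 park_code [ffun i => (c i).1].
Proof.
move=> /wep_codes_noncrossing ncl i; set s := [ffun i => _].
have lP j : (0 < len c j <= N)%N by rewrite /len ltn_ord.
have eqp : start_pos (fun a => (c a).1) = start_pos s.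
  by apply: funext => j; rewrite /start_pos ffunE.
have := noncrossing_unique (@pos_lt N c) (@pos_inj N c) erefl i lP ncl.
rewrite eqp -park_code_len /len => -[/ord_inj eq2].
by case: (c i) eq2 (ffunE (fun i => (c i).1) i) => c1 c2 /= -> e; rewrite /park_code -[in RHS]/s; congr (_, _).
Qed.

Definition park_classes s := class_seq (park_code s).

Lemma park_classes_inj : injective park_classes.
Proof.
move=> s s' eqs; apply/ffunP => i.
have /eq_in_map/(_ i (mem_enum _ i)) := eqs.
by move/iso_classE/uniserial_inj; case.
Qed.

Lemma max_wes_size_nakayama : max_wes_size A N.
Proof.
split=> [_ [s ws <-]|m ub]; first exact: wes_size_leq.
have hp := @wep_park_code [ffun=> 0].
rewrite -(class_seq_size hp); apply: ub; exists (park_classes [ffun=> 0]) => //.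
by apply/wesP; exists N, (park_code [ffun=> 0]).
Qed.

Lemma full_wesE : full_wes A = [set park_classes s | s in setT]%classic.
Proof.
apply/seteqP; split=> [q [wq mq]|_ [s _ <-]]; last first.
  have hp := @wep_park_code s; split; last by rewrite class_seq_size //; exact: max_wes_size_nakayama.
  by apply/wesP; exists N, (park_code s).
have sz : wes_size q = N.
  have [u1 l1] := mq; have [u2 l2] := max_wes_size_nakayama.
  by apply/eqP; rewrite eqn_leq; apply/andP; split; [exact: l1 u2|exact: l2 u1].
case/wesP: wq => r [c [hc qE]]; move: sz; rewrite qE class_seq_size // => rN.
move: c hc {qE}; rewrite rN => c hc.
exists [ffun i => (c i).1] => //; apply: eq_map => i /=.
by rewrite -(wep_park_code_unique hc).
Qed.

Lemma card_full_wes_nakayama : (full_wes A #= `I_(N ^ N))%card.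
Proof.
rewrite full_wesE.
have cardF : #|{ffun 'I_N -> 'Z_N}| = (N ^ N)%N by rewrite card_ffun !card_ord.
pose G (k : 'I_(#|{ffun 'I_N -> 'Z_N}|)) := park_classes (enum_val k).
have -> : [set park_classes s | s in setT]%classic = (G @` setT)%classic.
  apply/seteqP; split=> _ [s _ <-]; last by exists (enum_val s).
  by exists (enum_rank s); rewrite // /G enum_rankK.
apply: card_eq_trans (inj_card_eq _) _.
  by move=> x y _ _ /park_classes_inj/enum_val_inj.
rewrite -cardF card_eq_sym; exact: card_II.
Qed.
End Sequences.

Theorem theorem1p4 (K : fieldType) (n : nat) (hn : (2 <= n)%N) :
  max_wes_size (nakayama K n n) n /\
  (full_wes (nakayama K n n) #= `I_(n ^ n))%card.
Proof.
case: n hn => [|[|n']] // _.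
by split; [exact: max_wes_size_nakayama|exact: card_full_wes_nakayama].
Qed.
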